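(* Let $A$ be an algebra, $L:A\to\mathbb{R}$ linear with $L(1)=1$, and $K\subseteq X(A)$ closed, i.e. $K=K_Q$ for some quadratic module $Q$ in $A$ (every closed subset of $X(A)$ is of this form). If $L(\mathrm{Pos}_A(K))\subseteq[0,\infty)$, then: (i) For each $S\in I$ there exists a $\overline{\pi_S(K)}$-representing Radon measure $\mu_S$ for $L|_S$. (ii) There exists an $X(A)$-representing measure $\mu$ for $L$ on the cylinder $\sigma$-algebra $\Sigma_I$ supported on each $\pi_S^{-1}(\overline{\pi_S(K)})$ with $S\in I$ if and only if $\{\mu_S:S\in I\}$ is an exact projective system and the corresponding exact projective system $\{\mu_T:T\in\Lambda\}$ is thick. Moreover, if $Q$ is countably generated, then $\mu$ is a $K$-representing measure for $L$ on $\Sigma_I$. (iii) There exists a $K$-representing Radon measure $\nu$ for $L$ if and only if $\{\mu_S:S\in I\}$ fulfills Prokhorov's condition.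
   Context: All algebras are unital commutative real algebras, subalgebras contain the unit, and $X(A)\neq\emptyset$. For an algebra $S$, $X(S)$ is the set of unital $\mathbb{R}$-algebra homomorphisms $S\to\mathbb{R}$ (characters), with the weakest topology $\tau_{X(S)}$ such that for all $a\in S$ the function $\hat a:X(S)\to\mathbb{R}$, $\hat a(\alpha)=\alpha(a)$, is continuous; $\mathcal{B}_{X(S)}$ is its Borel $\sigma$-algebra. For subalgebras $S\subseteq T$ of $A$, $\pi_{S,T}:X(T)\to X(S)$ is the restriction map and $\pi_S:=\pi_{S,A}$; closures $\overline{\pi_S(K)}$ are taken in $X(S)$. $I$ is the set of all finitely generated subalgebras of $A$ and $\Lambda$ the set of all countably generated subalgebras of $A$, both ordered by inclusion. The cylinder $\sigma$-algebra $\Sigma_I$ is the smallest $\sigma$-algebra on $X(A)$ such that all $\pi_S:X(A)\to (X(S),\mathcal{B}_{X(S)})$, $S\in I$, are measurable. For $K\subseteq X(A)$, $\mathrm{Pos}_A(K):=\{a\in A:\alpha(a)\ge0\text{ for all }\alpha\in K\}$. A quadratic module in $A$ is a subset $Q\subseteq A$ with $1\in Q$, $Q+Q\subseteq Q$ and $a^2Q\subseteq Q$ for all $a\in A$; it is generated by $G\subseteq A$ if it is the smallest quadratic module containing $G$, and countably generated if $G$ can be taken countable. $K_Q:=\{\alpha\in X(A):\alpha(a)\ge0\ \forall a\in Q\}$. Representing measures: for an algebra $B$, $\ell:B\to\mathbb{R}$ linear, a $\sigma$-algebra $\Sigma$ on $X(B)$ and $K\in\Sigma$, a $K$-representing measure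 for $\ell$ on $\Sigma$ is a measure $\nu$ on $\Sigma$ supported in $K$, i.e. $\nu(X(B)\setminus K)=0$, with $\ell(a)=\int_{X(B)}\alpha(a)\,d\nu(\alpha)$ for all $a\in B$. A Radon measure on a Hausdorff space is a Borel measure that is locally finite and inner regular with respect to compact sets (on all Borel sets). A $K$-representing Radon measure is a $K$-representing measure on $\mathcal{B}_{X(B)}$ that is Radon. Exact systems: a family $\{\mu_S:S\in I\}$ of measures $\mu_S$ on $\mathcal{B}_{X(S)}$ is an exact projective system if $(\pi_{S,T})_\#\mu_T=\mu_S$ (pushforward) for all $S\subseteq T$ in $I$; similarly for $\Lambda$. If $\{\mu_S:S\in I\}$ is an exact projective system of Radon probability measures, then for every $T\in\Lambda$ there is a unique Radon probability measure $\mu_T$ on $\mathcal{B}_{X(T)}$ with $(\pi_{S,T})_\#\mu_T=\mu_S$ for all $S\in I$ with $S\subseteq T$, and $\{\mu_T:T\in\Lambda\}$ is an exact projective system, called the corresponding one. It is called thick if for every $T\in\Lambda$, $\mu_T(M)=0$ for all $M\in\mathcal{B}_{X(T)}$ with $\pi_T(X(A))\cap M=\emptyset$. Prokhorov's condition for a family $\{\mu_S:S\in I\}$ of Radon probability measures on the $X(S)$: for every $\varepsilon>0$ there is a compact $C_\varepsilon\subset X(A)$ such that $\mu_S(\pi_S(C_\varepsilon))\ge 1-\varepsilon$ for all $S\in I$. *)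

(* Defs.v *)
From HB Require Import structures.
From mathcomp Require Import all_boot all_order all_algebra.
From mathcomp Require Import all_classical all_reals all_analysis.
From mathcomp Require Import lra.

Set Implicit Arguments.
Unset Strict Implicit.
Unset Printing Implicit Defensive.
Import Order.TTheory GRing.Theory Num.Theory.
Import numFieldTopology.Exports numFieldNormedType.Exports.

Local Open Scope classical_set_scope.
Local Open Scope ring_scope.

(* Measurable spaces are pointed types in the library, so the standing
   assumption that X(A) is nonempty is carried by a witness.  The witness
   only serves as a default point: no definition below depends on which
   character has been chosen. *)
HB.mixin Record hasCharacter (R : realType) A of GRing.ComAlgebra R A := {
  a_character : {lrmorphism A -> R | *%R}
}.

#[short(type="charAlgType")]
HB.structure Definition CharAlgebra (R : realType) :=
  {A of GRing.ComAlgebra R A & hasCharacter R A}.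

(* X(A).  Since 1 is preserved and scalars act by multiplication in R, these
   are exactly the unital R-algebra homomorphisms A -> R. *)
Definition char_space (R : realType) (A : charAlgType R) : Type :=
  {lrmorphism A -> R | *%R}.

Definition char_eval (R : realType) (A : charAlgType R) (a : A)
  (alpha : char_space A) : R := (alpha : {lrmorphism A -> R | *%R}) a.

HB.instance Definition _ (R : realType) (A : charAlgType R) :=
  gen_eqMixin (char_space A).
HB.instance Definition _ (R : realType) (A : charAlgType R) :=
  gen_choiceMixin (char_space A).
HB.instance Definition _ (R : realType) (A : charAlgType R) :=
  isPointed.Build (char_space A) (@a_character R A).

(* The weakest topology making every evaluation map continuous. *)
HB.instance Definition _ (R : realType) (A : charAlgType R) :=
  Topological.copy (char_space A)
    (sup_topology (fun a : A =>
       Topological.on (initial_topology (@char_eval R A a)))).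

Section Subalgebras.
Context (R : realType) (A : charAlgType R).

Definition subalg (S : subalgClosed A) : Type := {a : A | a \in S}.

HB.instance Definition _ S := SubChoice.on (subalg S).
HB.instance Definition _ S := [SubChoice_isSubAlgebra of subalg S by <:].
HB.instance Definition _ S := [SubNzRing_isSubComNzRing of subalg S by <:].

Definition subalg_val (S : subalgClosed A) : subalg S -> A := \val.
HB.instance Definition _ S := GRing.RMorphism.on (@subalg_val S).
HB.instance Definition _ S := GRing.Linear.on (@subalg_val S).

HB.instance Definition _ S :=
  hasCharacter.Build R (subalg S) (@a_character R A \o @subalg_val S).

Definition subalg_incl (S T : subalgClosed A) (ST : {subset S <= T})
  (s : subalg S) : subalg T := Sub (val s) (ST _ (valP s)).

Fact subalg_incl_is_linear (S T : subalgClosed A) (ST : {subset S <= T}) :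
  linear (subalg_incl ST).
Proof. by move=> a x y; apply: val_inj. Qed.
Fact subalg_incl_is_monoid_morphism (S T : subalgClosed A)
  (ST : {subset S <= T}) :
  monoid_morphism (subalg_incl ST).
Proof. by split=> [|x y]; apply: val_inj. Qed.
HB.instance Definition _ (S T : subalgClosed A) (ST : {subset S <= T}) :=
  GRing.isLinear.Build R (subalg S) (subalg T) *:%R (subalg_incl ST)
    (subalg_incl_is_linear ST).
HB.instance Definition _ (S T : subalgClosed A) (ST : {subset S <= T}) :=
  GRing.isMonoidMorphism.Build (subalg S) (subalg T) (subalg_incl ST)
    (subalg_incl_is_monoid_morphism ST).

(* pi_S : X(A) -> X(S) *)
Definition restr (S : subalgClosed A) (alpha : char_space A) :
    char_space (subalg S) :=
  (alpha : {lrmorphism A -> R | *%R}) \o @subalg_val S.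

(* pi_{S,T} : X(T) -> X(S) *)
Definition restr_sub (S T : subalgClosed A) (ST : {subset S <= T})
    (alpha : char_space (subalg T)) : char_space (subalg S) :=
  (alpha : {lrmorphism subalg T -> R | *%R}) \o subalg_incl ST.

Definition restr_lin (L : {scalar A}) (S : subalgClosed A) :
    {scalar subalg S} := L \o @subalg_val S.

Definition subalg_generated (S : subalgClosed A) (G : set A) :=
  G `<=` [set` S] /\
  forall T : subalgClosed A, G `<=` [set` T] -> {subset S <= T}.

(* The index sets I and Lambda. *)
Definition fin_gen (S : subalgClosed A) :=
  exists2 G : set A, finite_set G & subalg_generated S G.
Definition count_gen (S : subalgClosed A) :=
  exists2 G : set A, countable G & subalg_generated S G.

End Subalgebras.

Section QuadraticModules.
Context (R : realType) (A : charAlgType R).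

Definition quadratic_module (Q : set A) :=
  [/\ Q 1, forall p q, Q p -> Q q -> Q (p + q)
    & forall a q, Q q -> Q (a ^+ 2 * q)].

Definition qm_count_gen (Q : set A) :=
  exists2 G : set A, countable G & Q = smallest quadratic_module G.

(* K_Q *)
Definition nonneg_set (Q : set A) : set (char_space A) :=
  [set alpha | forall a, Q a -> 0 <= char_eval a alpha].

(* Pos_A(K) *)
Definition pos_cone (K : set (char_space A)) : set A :=
  [set a | forall alpha, K alpha -> 0 <= char_eval a alpha].

End QuadraticModules.

Section CharSpaceTopology.
Context (R : realType) (A : charAlgType R).
Implicit Types (alpha beta : char_space A) (a b : A).

Lemma char_evalD a b alpha :
  char_eval (a + b) alpha = char_eval a alpha + char_eval b alpha.
Proof. by rewrite /char_eval raddfD. Qed.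
Lemma char_evalM a b alpha :
  char_eval (a * b) alpha = char_eval a alpha * char_eval b alpha.
Proof. by rewrite /char_eval rmorphM. Qed.
Lemma char_evalX a n alpha :
  char_eval (a ^+ n) alpha = char_eval a alpha ^+ n.
Proof. by rewrite /char_eval rmorphXn. Qed.
Lemma char_evalC (r : R) alpha : char_eval (r *: 1 : A) alpha = r.
Proof. by rewrite /char_eval linearZ /= rmorph1 mulr1. Qed.
Lemma char_eval1 alpha : char_eval (1 : A) alpha = 1.
Proof. by rewrite /char_eval rmorph1. Qed.

Lemma char_spaceP alpha beta :
  (forall a, char_eval a alpha = char_eval a beta) -> alpha = beta.
Proof.
case: alpha => f cf; case: beta => g cg /= h.
have {h} fg : f = g by apply: funext => a; exact: h.
subst g; congr GRing.LRMorphism.Pack.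
case: cf cg => [[p] [q] [r] ] [[p'] [q'] [r'] ].
by rewrite (Prop_irrelevance p' p) (Prop_irrelevance q' q) (Prop_irrelevance r' r).
Qed.

Lemma char_eval_continuous a : continuous (@char_eval R A a).
Proof.
move=> alpha; have /cvg_sup/(_ a) h : nbhs alpha --> alpha by [].
by apply: cvg_trans (@initial_continuous _ _ (@char_eval R A a) alpha);
  apply: cvg_app.
Qed.

Lemma char_space_hausdorff : hausdorff_space (char_space A).
Proof.
move=> alpha beta ab; apply: char_spaceP => a.
apply: (@Rhausdorff R) => U V.
move=> /(char_eval_continuous (x := alpha)) Ua.
move=> /(char_eval_continuous (x := beta)) Vb.
by have [x [? ?]] := ab _ _ Ua Vb; exists (char_eval a x).
Qed.

Lemma closed_nonneg_set (Q : set A) : closed (nonneg_set Q).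
Proof.
rewrite (_ : nonneg_set Q =
    \bigcap_(a in Q) (char_eval a @^-1` [set r : R | 0 <= r])).
  apply: closed_bigI => a _; apply: closed_comp; last exact: closed_ge.
  by move=> x _; exact: char_eval_continuous.
by [].
Qed.

Lemma quadratic_module_pos_cone (K : set (char_space A)) :
  quadratic_module (pos_cone K).
Proof.
split=> [alpha _|p q Kp Kq alpha Ka|a q Kq alpha Ka].
- by rewrite char_eval1.
- by rewrite char_evalD addr_ge0 ?Kp ?Kq.
- by rewrite char_evalM char_evalX mulr_ge0 ?sqr_ge0 ?Kq.
Qed.

Lemma closed_char_spaceP (K : set (char_space A)) :
  closed K <-> exists2 Q, quadratic_module Q & K = nonneg_set Q.
Proof.
split=> [Kcl|[Q _ ->]]; last exact: closed_nonneg_set.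
exists (pos_cone K); first exact: quadratic_module_pos_cone.
apply/seteqP; split=> [alpha Ka a|alpha Na]; first exact.
apply: contrapT => nKa.
pose D := [set p : A * R | [/\ 0 < p.2, char_eval p.1 alpha = 0
  & forall beta, 0 <= char_eval p.1 beta]].
pose F := filter_from D (fun p => [set beta | char_eval p.1 beta < p.2]).
have FF : Filter F.
  apply: filter_from_filter.
    by exists (0, 1); split=> //= [|b]; rewrite /char_eval raddf0.
  move=> [a e] [b d] [/= e0 a0 ap] [/= d0 b0 bp].
  exists (a + b, Num.min e d) => /=.
    split=> /= [||c]; first by rewrite lt_min e0.
      by rewrite char_evalD a0 b0 addr0.
    by rewrite char_evalD addr_ge0.
  move=> c /=; rewrite char_evalD lt_min => /andP[h1 h2].
  by have := ap c; have := bp c; lra.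
have Fa : F --> alpha.
  apply/cvg_sup => a U; rewrite nbhsE => -[V [[W Wo WV] Va] VU].
  have /nbhs_ballP[r r0 rW] : nbhs (char_eval a alpha) W.
    by apply: open_nbhs_nbhs; split=> //; move: Va; rewrite -WV.
  exists ((a - char_eval a alpha *: 1) ^+ 2, r ^+ 2).
    split=> /= [||b]; first by rewrite exprn_gt0.
      by rewrite char_evalX -scaleNr char_evalD char_evalC subrr expr0n.
    by rewrite char_evalX sqr_ge0.
  move=> b /=; rewrite char_evalX -scaleNr char_evalD char_evalC => hb.
  apply: VU; rewrite -WV; apply: rW; rewrite /ball /= distrC.
  by rewrite -ltr_sqr ?nnegrE ?(ltW r0)// real_normK// num_real.
have [|[b e] /= [e0 b0 bp] bK] := Fa (~` K).
  by apply: open_nbhs_nbhs; split=> //; rewrite openC.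
have : pos_cone K (b + (- e) *: 1).
  move=> beta Kb; rewrite char_evalD char_evalC subr_ge0 leNgt.
  by apply/negP => /bK.
by move=> /Na; rewrite char_evalD char_evalC b0 add0r oppr_ge0 leNgt e0.
Qed.
End CharSpaceTopology.

Definition borel_space (X : ptopologicalType) : Type :=
  g_sigma_algebraType (@open X).
HB.instance Definition _ (X : ptopologicalType) :=
  Measurable.on (borel_space X).

Definition radon (R : realType) (X : ptopologicalType)
    (mu : {measure set (borel_space X) -> \bar R}) :=
  (forall x : X, exists U : set X, [/\ open U, U x & (mu U < +oo)%E]) /\
  (forall B : set (borel_space X), measurable B ->
     mu B = ereal_sup [set mu C | C in [set C : set X | compact C /\ C `<=` B]]).

Section RepresentingMeasures.
Context (R : realType) (B : charAlgType R).

(* The sigma-algebra on X(B) is the one generated by [G]. *)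
Definition representing (G : set (set (char_space B))) (l : {scalar B})
    (K : set (char_space B))
    (nu : {measure set (g_sigma_algebraType G) -> \bar R}) :=
  [/\ measurable (K : set (g_sigma_algebraType G)), nu (~` K) = 0%E
    & forall a : B,
        nu.-integrable setT (fun alpha => (char_eval a alpha)%:E) /\
        (l a)%:E = (\int[nu]_alpha (char_eval a alpha)%:E)%E].

Definition radon_representing (l : {scalar B}) (K : set (char_space B))
    (nu : {measure set (borel_space (char_space B)) -> \bar R}) :=
  radon nu /\ representing l K nu.

End RepresentingMeasures.

Section ProjectiveSystems.
Context (R : realType) (A : charAlgType R).

(* Generators of the cylinder sigma-algebra Sigma_I on X(A). *)
Definition cylinders : set (set (char_space A)) :=
  [set E | exists S : subalgClosed A, fin_gen S /\
     exists2 M : set (borel_space (char_space (subalg S))),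
       measurable M & E = @restr R A S @^-1` M].

Definition cylinder_space : Type := g_sigma_algebraType cylinders.
HB.instance Definition _ := Measurable.on cylinder_space.

(* A family of measures on the X(S); the predicates below only look at the S
   in the relevant index set, the other members being junk. *)
Definition measure_family : Type := forall S : subalgClosed A,
  {measure set (borel_space (char_space (subalg S))) -> \bar R}.

Definition restr_push (S T : subalgClosed A) (ST : {subset S <= T})
    (m : {measure set (borel_space (char_space (subalg T))) -> \bar R}) :
    set (borel_space (char_space (subalg S))) -> \bar R :=
  pushforward m (restr_sub ST : borel_space (char_space (subalg T)) ->
                                borel_space (char_space (subalg S))).

Definition exact_system (J : set (subalgClosed A)) (mu : measure_family) :=
  forall (S T : subalgClosed A) (ST : {subset S <= T}), J S -> J T ->
  forall M : set (borel_space (char_space (subalg S))), measurable M ->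
    restr_push ST (mu T) M = mu S M.

Definition corresponding_system (mu muL : measure_family) :=
  forall T : subalgClosed A, count_gen T ->
  [/\ radon (muL T), muL T setT = 1%E
    & forall (S : subalgClosed A) (ST : {subset S <= T}), fin_gen S ->
      forall M : set (borel_space (char_space (subalg S))), measurable M ->
        restr_push ST (muL T) M = mu S M].

Definition thick (muL : measure_family) :=
  forall T : subalgClosed A, count_gen T ->
  forall M : set (borel_space (char_space (subalg T))), measurable M ->
    range (@restr R A T) `&` M = set0 -> muL T M = 0%E.

Definition prokhorov (mu : measure_family) :=
  forall e : R, 0 < e -> exists2 C : set (char_space A), compact C &
    forall S : subalgClosed A, fin_gen S ->
      ((1 - e)%:E <= mu S (@restr R A S @` C))%E.

Definition local_solutions (L : {scalar A}) (K : set (char_space A))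
    (mu : measure_family) :=
  forall S : subalgClosed A, fin_gen S ->
    radon_representing (restr_lin L S) (closure (@restr R A S @` K)) (mu S).

(* X(A)-representing measures on Sigma_I that are supported on every
   pi_S^-1(closure (pi_S(K))) with S in I. *)
Definition cylinder_solution (L : {scalar A}) (K : set (char_space A))
    (mu : {measure set cylinder_space -> \bar R}) :=
  representing L setT mu /\
  forall S : subalgClosed A, fin_gen S ->
    mu (~` (@restr R A S @^-1` closure (@restr R A S @` K))) = 0%E.

End ProjectiveSystems.

(* Main.v *)
(* A linear functional dominated by a cone of majorants and tight on a lattice
   of bounded continuous functions is integration against a Radon measure
   (Hahn-Banach through maximal cones, then the Riesz construction: inner mass
   of open sets, outer measure, Caratheodory). If the majorants of [f] include
   [L a] whenever [f <= a] on [K], the truncations of [a] at level [t] differ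
   from [a] by at most [a ^+ 2 / t], so the measure also represents [L] on the
   unbounded functions given by the algebra.

   (i) Take as majorants of [f] the numbers [l a] with [f <= a] on the closure
   of [pi_S(K)]; tightness comes from the proper function that is the sum of
   the squares of the generators of [S].

   (iii) Take as majorants of [f] the numbers [c] such that, for every large
   [S] in I, [f <= g o pi_S] on [K] for a continuous [g] with integral at most
   [c] against [mu_S]; Prokhorov's condition gives tightness.

   (ii) For countably generated [T] the space X(T) has a countable base, hence
   [pi_T] is measurable for the cylinder sigma-algebra, and every Borel
   probability on X(T) is Radon. Conversely every cylinder set is
   [pi_T^-1(M)] for some [T] in Lambda, and thickness says exactly that
   [mu_T(M)] depends only on this preimage. *)
Require Import Defs.
From HB Require Import structures.
From mathcomp Require Import all_boot all_order all_algebra.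
From mathcomp Require Import all_classical all_reals all_analysis.
From mathcomp Require Import measurable_realfun lra.

Set Implicit Arguments.
Unset Strict Implicit.
Unset Printing Implicit Defensive.
Import Order.TTheory GRing.Theory Num.Theory.
Import numFieldTopology.Exports numFieldNormedType.Exports.

Local Open Scope classical_set_scope.
Local Open Scope ring_scope.

(** * Hahn-Banach through maximal cones *)

(** Character spaces need not be locally compact beyond the finitely generated case, so the Riesz
    construction cannot rest on compactly supported functions. Tightness takes over: up to a small
    error under [l], inequalities between functions only have to hold on a compact set, and every
    covering argument takes place there. Majorants are kept as a set of pairs [(f, c)] instead of a
    sublinear functional, so that no finiteness has to be settled beforehand; the resulting
    functional is linear where both [f] and [- f] have majorants. Domination by elements of the
    algebra is a single hypothesis with four uses: positivity, normalization, support in [K] and the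
    bound on second moments. The family in (iii) carries no compatibility, so integrating [g]
    against [mu S] does not by itself define a functional of the cylinder function that [g] induces.
    A majorant therefore has to be valid for all large [S], and the cone argument selects one
    functional below all of them. *)

Section ConeFunctional.
Context (R : realType) (V : lmodType R).
Implicit Types (P M : set (V * R)) (f g : V).

(** A pair [(f, c)] is read as: [c] majorizes [f]. Thus [P] acts as the epigraph of a sublinear
    functional, and the last clause says that zero has no negative majorant. *)
Definition proper_cone P :=
  [/\ P (0, 0),
      forall f g c d, P (f, c) -> P (g, d) -> P (f + g, c + d),
      forall (t : R) f c, 0 < t -> P (f, c) -> P (t *: f, t * c)
    & forall c, P (0, c) -> 0 <= c].

(** Zorn's lemma is applied to the sets whose union with [P] is proper, because the empty chain also
    needs a bound and its union is empty. *)
Lemma maximal_proper_cone P : proper_cone P ->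
  exists M, [/\ proper_cone M, P `<=` M
    & forall B, proper_cone B -> M `<=` B -> B `<=` M].
Proof.
move=> goodP.
have [F Fgood Ftot|C [goodC maxC]] :=
    @Zorn_bigcup _ (fun C => proper_cone (C `|` P)); last first.
  exists (C `|` P); split=> // B goodB CPB.
  have [CB|CB] := pselect (C = B); first by rewrite CB => x Bx; left.
  exfalso; apply: (maxC B).
    split=> [x Cx|BC]; first by apply: CPB; left.
    by apply: CB; apply/seteqP; split=> // x Cx; apply: CPB; left.
  by rewrite setUidl // => x Px; apply: CPB; right.
have [P0 Pa Ps Pp] := goodP; split=> [|f g c d|t f c t0|c].
- by right.
- case=> [[X FX Xf]|Pf].
    case=> [[Y FY Yg]|Pg].
      have [XY|YX] := Ftot _ _ FX FY.
        have [_ /(_ f g c d) h _ _] := Fgood _ FY.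
        by case: h => [||?|?]; [left; exact: XY|left| left; exists Y|right].
      have [_ /(_ f g c d) h _ _] := Fgood _ FX.
      by case: h => [||?|?]; [left|left; exact: YX| left; exists X|right].
    have [_ /(_ f g c d) h _ _] := Fgood _ FX.
    by case: h => [||?|?]; [left|right| left; exists X|right].
  case=> [[Y FY Yg]|Pg]; last by right; exact: Pa.
  have [_ /(_ f g c d) h _ _] := Fgood _ FY.
  by case: h => [||?|?]; [right|left| left; exists Y|right].
- case=> [[X FX Xf]|Pf]; last by right; exact: Ps.
  have [_ _ /(_ t f c t0) h _] := Fgood _ FX.
  by case: h => [|?|?]; [left| left; exists X|right].
- case=> [[X FX Xc]|]; last exact: Pp.
  by have [_ _ _ h] := Fgood _ FX; apply: h; left.
Qed.

(** Adding the ray through [(f, c)] must destroy properness, so some [(g + t *: f, d + t * c)] with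
    [M (g, d)] and [t > 0] has first component 0 and negative second component. Dividing by [t]
    gives the majorant [t^-1 * d] of [- f]. *)
Lemma maximal_proper_cone_opp M : proper_cone M ->
  (forall B, proper_cone B -> M `<=` B -> B `<=` M) ->
  forall f c, ~ M (f, c) -> exists2 d, M (- f, d) & d < - c.
Proof.
move=> [M0 Ma Ms Mp] maxM f c nM; apply: contrapT => noD.
pose B := [set x : V * R | exists (t : R) g d,
  [/\ 0 <= t, M (g, d) & x = (g + t *: f, d + t * c)]].
apply: nM; apply: (maxM B).
- split.
  + by exists 0, 0, 0; split=> //; rewrite scale0r mul0r !addr0.
  + move=> _ _ _ _ [t [g [d [t0 Mg [-> ->]]]]] [s [h [e [s0 Mh [-> ->]]]]].
    exists (t + s), (g + h), (d + e); split; [exact: addr_ge0|exact: Ma|].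
    by rewrite scalerDl mulrDl; congr (_, _); rewrite addrACA.
  + move=> s _ _ s0 [t [g [d [t0 Mg [-> ->]]]]].
    exists (s * t), (s *: g), (s * d); split.
    * by rewrite mulr_ge0 // ltW.
    * exact: Ms.
    * by rewrite scalerDr scalerA mulrDr mulrA.
  + move=> e [t [g [d [t0 Mg [eg ->]]]]].
    have [t0'|tp] := eqVneq t 0.
      move: eg Mg; rewrite t0' scale0r addr0 mul0r addr0 => <-; exact: Mp.
    have {t0}tp : 0 < t by rewrite lt_neqAle eq_sym tp.
    rewrite leNgt; apply/negP => neg; apply: noD.
    exists (t^-1 * d).
      have -> : - f = t^-1 *: g.
        apply: (@scalerI _ _ t); first by rewrite gt_eqF.
        rewrite scalerA divff ?gt_eqF // scale1r scalerN.
        by apply/eqP; rewrite eq_sym -addr_eq0 -eg.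
      by apply: Ms => //; rewrite invr_gt0.
    by rewrite mulrC ltr_pdivrMr // mulNr mulrC; lra.
- move=> [g d] Mg; exists 0, g, d; split=> //.
  by rewrite scale0r mul0r !addr0.
- by exists 1, 0, 0; rewrite scale1r mul1r !add0r.
Qed.

(* For a maximal cone [M] the sections {c | M (f, c)} and {c | M (- f, - c)}
   are complementary half-lines, so their common end point is linear in [f]. *)
Theorem cone_functional P : proper_cone P ->
  let D := [set f | (exists c, P (f, c)) /\ (exists c, P (- f, c))] in
  exists l : V -> R,
    [/\ forall f g, D f -> D g -> l (f + g) = l f + l g,
        forall (t : R) f, D f -> l (t *: f) = t * l f
      & forall f c, D f -> P (f, c) -> l f <= c].
Proof.
move=> goodP D.
have [M [goodM PM maxM]] := maximal_proper_cone goodP.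
have Mopp := maximal_proper_cone_opp goodM maxM.
have [M0 Ma Ms Mp] := goodM.
pose S f := [set c | M (f, c)]; pose l f := inf (S f).
pose DM := [set f | S f !=set0 /\ S (- f) !=set0].
have DDM : D `<=` DM.
  by move=> f [[c Pc] [d Pd]]; split; [exists c|exists d]; exact: PM.
have DMN f : DM f -> DM (- f) by move=> [? ?]; split; rewrite ?opprK.
have DMD f g : DM f -> DM g -> DM (f + g).
  move=> [[a ?] [b ?]] [[c ?] [d ?]]; split; first by exists (a + c); exact: Ma.
  by exists (b + d); rewrite opprD; exact: Ma.
have DMZ (t : R) f : 0 < t -> DM f -> DM (t *: f).
  move=> t0 [[a ?] [b ?]]; split; first by exists (t * a); exact: Ms.
  by exists (t * b); rewrite -scalerN; exact: Ms.
have lbS f : DM f -> has_lbound (S f).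
  move=> [_ [d Md]]; exists (- d) => c Mc.
  by rewrite -subr_ge0 opprK; apply: Mp; rewrite -(subrr f); exact: Ma.
have l_le f c : DM f -> M (f, c) -> l f <= c.
  by move=> Df Mc; apply: ge_inf => //; exact: lbS.
have le_l f c : DM f -> (forall d, M (f, d) -> c <= d) -> c <= l f.
  by move=> [S0 _] h; apply: lb_le_inf.
(* Maximality enters here: [l f - e] is no majorant of [f], so [- f] has one below [e - l f].
   Additivity then follows from subadditivity for [f], [g] and for [- f], [- g]. *)
have lN f : DM f -> l (- f) = - l f.
  move=> Df; have DNf := DMN _ Df; apply/eqP; rewrite eq_le; apply/andP; split.
    rewrite lerNr; apply/ler_addgt0Pr => e e0; rewrite -lerBlDr.
    have [Mc|/Mopp[d Md dlt]] := pselect (M (f, l f - e)).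
      by have := l_le _ _ Df Mc; lra.
    by have := l_le _ _ DNf Md; lra.
  apply: (le_l) => // d Md; rewrite lerNl; apply: (le_l) => // c Mc.
  by rewrite lerNl -subr_ge0 opprK; apply: Mp; rewrite -(subrr f) addrC; apply: Ma.
have lD_le f g : DM f -> DM g -> l (f + g) <= l f + l g.
  move=> Df Dg; rewrite -lerBlDr; apply: (le_l) => // c Mc.
  rewrite lerBlDr -lerBlDl; apply: (le_l) => // d Md.
  by rewrite lerBlDl; apply: (l_le); [exact: DMD|exact: Ma].
have lZ_le (t : R) f : 0 < t -> DM f -> l (t *: f) <= t * l f.
  move=> t0 Df; rewrite mulrC -ler_pdivrMr //; apply: (le_l) => // c Mc.
  by rewrite ler_pdivrMr // mulrC; apply: (l_le); [exact: DMZ|exact: Ms].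
have lD f g : DM f -> DM g -> l (f + g) = l f + l g.
  move=> Df Dg; apply/eqP; rewrite eq_le lD_le //=.
  rewrite -[leRHS]opprK -lN; last exact: DMD.
  rewrite opprD lerNr; apply: le_trans (lD_le _ _ (DMN _ Df) (DMN _ Dg)) _.
  by rewrite !lN // opprD.
have lZ (t : R) f : 0 < t -> DM f -> l (t *: f) = t * l f.
  move=> t0 Df; apply/eqP; rewrite eq_le lZ_le //=.
  have := lZ_le t^-1 (t *: f); rewrite invr_gt0 => /(_ t0 (DMZ _ _ t0 Df)).
  by rewrite scalerA mulVf ?gt_eqF // scale1r mulrC ler_pdivlMr // mulrC.
exists l; split=> [f g /DDM ? /DDM|t f /DDM Df|f c /DDM ? /PM].
- exact: lD.
- have [t0|t0|->] := ltrgtP t 0.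
  + have -> : t *: f = - (- t *: f) by rewrite scaleNr opprK.
    by rewrite lN ?lZ ?mulNr ?opprK ?oppr_gt0 //; apply: DMZ; rewrite ?oppr_gt0.
  + exact: lZ.
  + rewrite scale0r mul0r.
    by have := lD _ _ Df (DMN _ Df); rewrite subrr lN // subrr.
- exact: l_le.
Qed.

End ConeFunctional.

(** * Borel sets of a topological space *)

Lemma measurable_continuous (R : realType) (X : ptopologicalType) (f : X -> R) :
  continuous f -> measurable_fun [set: borel_space X] f.
Proof.
move=> fc; apply: (measurability _ (RGenOpens.measurableE R)).
move=> _ [_ [a [b ->]] <-]; rewrite setTI; apply: sub_sigma_algebra.
apply: open_comp; first by move=> x _; exact: fc.
exact: interval_open.
Qed.

Lemma borel_open (X : ptopologicalType) (U : set X) :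
  open U -> measurable (U : set (borel_space X)).
Proof. exact: sub_sigma_algebra. Qed.

Lemma borel_closed (X : ptopologicalType) (F : set X) :
  closed F -> measurable (F : set (borel_space X)).
Proof.
by move=> Fc; rewrite -[F]setCK; apply: measurableC; apply: borel_open; rewrite openC.
Qed.

Lemma bounded_continuous_integrable (R : realType) (X : ptopologicalType)
    (nu : {measure set (borel_space X) -> \bar R}) (f : X -> R) (c : R) :
  (nu setT < +oo)%E -> continuous f -> (forall x, `|f x| <= c) ->
  nu.-integrable setT (EFin \o f).
Proof.
move=> nufin fc fb; apply: measurable_bounded_integrable => //.
  exact: measurable_continuous.
exists c; split; first exact: num_real.
by move=> r cr x _; apply: le_trans (fb x) (ltW cr).
Qed.

(** * Riesz representation of tight functionals *)

Section TightFunctionals.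
Context (R : realType) (X : ptopologicalType).
Implicit Types (f g h : X -> R) (U V C D : set X).

(** There are two instances: all bounded continuous functions, and those that factor through some
    X(S) with S in I. A bound from above suffices as a field, since [- f] supplies the other one. *)
Record function_lattice (E : set (X -> R)) : Prop := {
  lattice_continuous : forall f, E f -> continuous f;
  lattice_bounded : forall f, E f -> exists c, forall x, f x <= c;
  lattice_cst : forall c, E (cst c);
  latticeD : forall f g, E f -> E g -> E (f + g);
  latticeZ : forall (c : R) f, E f -> E (c *: f);
  lattice_max : forall f g, E f -> E g -> E (f \max g);
  lattice_separates : forall U x, open U -> U x ->
    exists f, [/\ E f, 0 < f x & forall y, ~ U y -> f y <= 0] }.

(** The last clause replaces local compactness: it lets an inequality that is checked only on [C]
    pass to [l] up to a small error, see [tight_approx]. *)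
Record tight_functional (E : set (X -> R)) (l : (X -> R) -> R) : Prop := {
  tightD : forall f g, E f -> E g -> l (f + g) = l f + l g;
  tightZ : forall (c : R) f, E f -> l (c *: f) = c * l f;
  tight_ge0 : forall f, E f -> (forall x, 0 <= f x) -> 0 <= l f;
  tight1 : l (cst 1) = 1;
  tight_compact : forall e : R, 0 < e -> exists2 C, compact C &
    forall f, E f -> (forall x, 0 <= f x <= 1) ->
      (forall x, C x -> f x = 0) -> l f <= e }.

Context (E : set (X -> R)) (l : (X -> R) -> R).
Context (EL : function_lattice E) (lT : tight_functional E l).

Lemma latticeN f : E f -> E (- f).
Proof. by move=> Ef; rewrite -scaleN1r; exact: latticeZ. Qed.

Lemma latticeB f g : E f -> E g -> E (f - g).
Proof. by move=> Ef Eg; apply: latticeD => //; exact: latticeN. Qed.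

Lemma lattice_min f g : E f -> E g -> E (f \min g).
Proof.
move=> Ef Eg; suff -> : f \min g = - ((- f) \max (- g)).
  by apply: latticeN; apply: lattice_max => //; exact: latticeN.
by apply/funext => x /=; rewrite !fctE oppr_max !opprK.
Qed.

Lemma tightN f : E f -> l (- f) = - l f.
Proof. by move=> Ef; rewrite -scaleN1r (tightZ lT) // mulN1r. Qed.

Lemma tightB f g : E f -> E g -> l (f - g) = l f - l g.
Proof. by move=> Ef Eg; rewrite (tightD lT) ?tightN//; exact: latticeN. Qed.

Lemma tight_le f g : E f -> E g -> (forall x, f x <= g x) -> l f <= l g.
Proof.
move=> Ef Eg fg; rewrite -subr_ge0 -tightB //.
apply: (tight_ge0 lT); first exact: latticeB.
by move=> x; rewrite !fctE subr_ge0.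
Qed.

Lemma tight_cst (c : R) : l (cst c) = c.
Proof.
have -> : cst c = c *: cst 1 :> (X -> R).
  by apply/funext => x; rewrite /= !fctE /= /GRing.scale /= mulr1.
by rewrite (tightZ lT) ?(tight1 lT) ?mulr1 //; exact: lattice_cst.
Qed.

(** A test function vanishes off [U] but may fail to have compact support in [U]; compactness is
    recovered from tightness. *)
Definition test_function U f :=
  [/\ E f, forall x, 0 <= f x <= 1 & forall x, ~ U x -> f x = 0].

Definition clamp f : X -> R := cst 0 \max (cst 1 \min f).

Lemma clampE f x : clamp f x = Num.max 0 (Num.min 1 (f x)).
Proof. by []. Qed.

Lemma lattice_clamp f : E f -> E (clamp f).
Proof.
move=> Ef; apply: (lattice_max EL); first exact: lattice_cst.
by apply: lattice_min => //; exact: lattice_cst.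
Qed.

Lemma clamp_itv f x : 0 <= clamp f x <= 1.
Proof. by rewrite clampE le_max lexx ge_max ge_min lexx ler01. Qed.

Lemma test_clamp U f : E f -> (forall x, ~ U x -> f x <= 0) ->
  test_function U (clamp f).
Proof.
move=> Ef fU; split=> [|x|x /fU f0]; [exact: lattice_clamp|exact: clamp_itv|].
by rewrite clampE; apply/max_idPl; rewrite ge_min f0 orbT.
Qed.

Lemma test0 U : test_function U (cst 0).
Proof.
by split=> // [|x]; [exact: (lattice_cst EL)|rewrite /= lexx ler01].
Qed.

Lemma test_le1 U f : test_function U f -> l f <= 1.
Proof.
move=> [Ef f01 _]; rewrite -(tight_cst 1); apply: tight_le => //.
  exact: lattice_cst.
by move=> x; have /andP[] := f01 x.
Qed.

(** Each point of [D] has a function of [E] that takes the value 2 there and is at most 0 off [U].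
    Finitely many of the sets where these exceed 1 cover [D], and the clamped maximum of the
    corresponding functions is the required [h]. *)
Lemma urysohn_compact D U : compact D -> open U -> D `<=` U ->
  exists2 h, test_function U h & forall x, D x -> h x = 1.
Proof.
move=> Dc Uo DU.
have sep x : exists f, D x -> [/\ E f, 1 < f x & forall y, ~ U y -> f y <= 0].
  have [Dx|nD] := pselect (D x); last by exists (cst 0).
  have [f [Ef f0 fU]] := lattice_separates EL Uo (DU _ Dx).
  exists ((2 / f x) *: f) => _; split=> [||y /fU fy0]; first exact: latticeZ.
    by rewrite fctE /GRing.scale /= divfK ?gt_eqF // ltr1n.
  rewrite fctE /GRing.scale /= mulr_ge0_le0 // divr_ge0 //; exact: ltW.
have [F FP] := choice sep.
have Fo x : D x -> open [set y | 1 < F x y].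
  move=> /FP[/(lattice_continuous EL) Fc _ _].
  exact: (open_comp (fun y _ => Fc y) (@open_gt _ 1)).
move: Dc; rewrite compact_cover => /(_ X D (fun x => [set y | 1 < F x y]) Fo).
case=> [x Dx|S SD DS]; first by exists x => //=; have [] := FP _ Dx.
pose m (s : seq X) : X -> R := fun y => \big[Num.max/0]_(x <- s) F x y.
have mP (s : seq X) : (forall x, x \in s -> D x) ->
    E (m s) /\ (forall y, ~ U y -> m s y <= 0).
  elim: s => [_|x s IH sD].
    have -> : m [::] = cst 0 by apply/funext => y; rewrite /m big_nil.
    by split=> [|y _]; [exact: lattice_cst|].
  have -> : m (x :: s) = F x \max m s.
    by apply/funext => y; rewrite /m big_cons.
  have [Em mU] := IH (fun z zs => sD z (@mem_behead _ (x :: s) z zs)).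
  have [EF _ FU] := FP x (sD x (mem_head _ _)).
  split=> [|y nUy]; first exact: lattice_max.
  by rewrite /= ge_max FU //= mU.
have [|Em mU] := mP (finmap.enum_fset S); first by move=> x /SD; rewrite inE.
exists (clamp (m (finmap.enum_fset S))); first exact: test_clamp.
move=> y /DS[x /= xS Fx]; rewrite clampE.
suff m1 : 1 <= m (finmap.enum_fset S) y by rewrite (min_idPl m1); apply/max_idPr.
apply: le_trans (ltW Fx) _; rewrite /m.
have {}xS : x \in finmap.enum_fset S by [].
elim: (finmap.enum_fset S) xS => // z s IH; rewrite in_cons big_cons le_max.
by case/orP=> [/eqP ->|/IH ->]; rewrite ?lexx ?orbT.
Qed.

(** The clamped excess of [f] over [g + e] vanishes on [C], so it costs at most [e]. Clamping at 1
    cuts nothing off, because [f <= 1] and [g >= 0]; hence [f] is at most the sum of [g], [e] and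
    this excess. *)
Lemma tight_approx f g (C : set X) (e : R) : E f -> E g ->
  (forall x, f x <= 1) -> (forall x, 0 <= g x) -> 0 <= e ->
  (forall h, E h -> (forall x, 0 <= h x <= 1) ->
     (forall x, C x -> h x = 0) -> l h <= e) ->
  (forall x, C x -> f x <= g x + e) -> l f <= l g + 2 * e.
Proof.
move=> Ef Eg f1 g0 e0 tC fg; pose h := clamp (f - g - cst e).
have Ece := lattice_cst EL e; have Efg := latticeB Ef Eg.
have Eh : E h by apply: lattice_clamp; exact: latticeB.
have lh : l h <= e.
  apply: tC => // [x|x Cx]; first exact: clamp_itv.
  rewrite /h clampE; apply/max_idPl; rewrite ge_min; apply/orP; right.
  by rewrite !fctE /=; have := fg x Cx; lra.
have : l f <= l (g + cst e + h).
  apply: tight_le => //; first by do 2 apply: latticeD => //.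
  move=> x; rewrite !fctE /h clampE /=.
  have := f1 x; have := g0 x; rewrite maxEle minEle !fctE /=.
  by do 2 case: ifPn => //; rewrite -?ltNge; lra.
have Ege : E (g + cst e) by exact: latticeD.
by rewrite !(tightD lT) // tight_cst; lra.
Qed.

Definition open_mass U := sup [set l f | f in test_function U].

Let has_sup_mass U : has_sup [set l f | f in test_function U].
Proof.
split; first by exists (l (cst 0)), (cst 0) => //; exact: test0.
by exists 1 => _ [f /test_le1 f1 <-].
Qed.

Lemma open_mass_ub U f : test_function U f -> l f <= open_mass U.
Proof. by move=> Uf; apply: sup_upper_bound => //; exists f. Qed.

Lemma open_mass_le U (c : R) :
  (forall f, test_function U f -> l f <= c) -> open_mass U <= c.
Proof.
move=> h; apply: ge_sup; first by have [] := has_sup_mass U.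
by move=> _ [f /h ? <-].
Qed.

Lemma open_mass_ge0 U : 0 <= open_mass U.
Proof. by rewrite -(tight_cst 0); apply: open_mass_ub; exact: test0. Qed.

Lemma open_mass_mono U V : U `<=` V -> open_mass U <= open_mass V.
Proof.
move=> UV; apply: open_mass_le => f [Ef f01 fU]; apply: open_mass_ub.
by split=> // x nV; apply: fU => /UV.
Qed.

Lemma open_massT : open_mass setT = 1.
Proof.
apply/eqP; rewrite eq_le; apply/andP; split.
  by apply: open_mass_le => f /test_le1.
rewrite -(tight_cst 1); apply: open_mass_ub; split=> [|x|x []//].
  exact: lattice_cst.
by rewrite /= lexx ler01.
Qed.

Lemma open_mass0 : open_mass set0 = 0.
Proof.
apply/eqP; rewrite eq_le open_mass_ge0 andbT; apply: open_mass_le => f [_ _ f0].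
by rewrite -(tight_cst 0) (_ : f = cst 0) //; apply/funext => x; exact: f0.
Qed.

Lemma compact_level f C (e : R) : E f -> compact C ->
  compact (C `&` [set x | e <= f x]).
Proof.
move=> Ef Cc; apply: compact_closedI => //.
apply: (@preimage_closed _ _ f [set r | e <= r]); last exact: closed_ge.
by move=> x _; exact: (lattice_continuous EL Ef).
Qed.

(** A substitute for a partition of unity: [hV] is 1 on the part of [D] outside [U], so the points
    of [D] where [hV] is not close to 1 form a compact subset [D'] of [U], and [hU] is 1 there. On
    [C] this gives [f <= hU + hV + e / 2]. *)
Lemma open_mass_setU U V : open U -> open V ->
  open_mass (U `|` V) <= open_mass U + open_mass V.
Proof.
move=> Uo Vo; apply: open_mass_le => f [Ef f01 fUV].
apply/ler_addgt0Pr => e e0; have e20 : 0 < e / 2 by rewrite divr_gt0.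
have [C Cc tC] := tight_compact lT e20.
pose D := C `&` [set x | e / 2 <= f x].
have Dc : compact D by exact: compact_level.
have DUV : D `<=` U `|` V.
  move=> x [_ /= fx]; apply: contrapT => /fUV fx0.
  by move: fx; rewrite fx0 leNgt e20.
have [||hV hVt hV1] := @urysohn_compact (D `&` ~` U) V _ Vo.
- by apply: compact_closedI => //; rewrite closedC.
- by move=> x [/DUV[]].
have [EhV hV01 _] := hVt.
pose D' := D `&` [set x | e / 2 <= 1 - hV x].
have D'c : compact D'.
  rewrite /D' (_ : [set x | _] = [set x | e / 2 <= (cst 1 - hV) x]) //.
  by apply: compact_level => //; apply: latticeB => //; exact: lattice_cst.
have [|hU hUt hU1] := @urysohn_compact D' U D'c Uo.
  move=> x [Dx /= hx]; apply: contrapT => nU.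
  by move: hx; rewrite hV1 // subrr leNgt e20.
have [EhU hU01 _] := hUt.
have Eh : E (hU + hV) by exact: latticeD.
apply: le_trans (lerD (lerD (open_mass_ub hUt) (open_mass_ub hVt)) (lexx e)).
rewrite -(tightD lT) //.
have -> : e = 2 * (e / 2) by rewrite mulrC divfK.
apply: (tight_approx (C := C)) => //.
- by move=> x; have /andP[] := f01 x.
- move=> x; rewrite fctE; have /andP[? _] := hU01 x; have /andP[? _] := hV01 x.
  exact: addr_ge0.
- exact: ltW.
- move=> x Cx; rewrite fctE; have /andP[hU0 _] := hU01 x.
  have /andP[hV0 _] := hV01 x; have /andP[_ fx1] := f01 x.
  have [fx|fx] := leP (e / 2) (f x); last lra.
  have [hx|hx] := leP (e / 2) (1 - hV x); last lra.
  by have := hU1 x (conj (conj Cx fx) hx); lra.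
Qed.

Lemma open_mass_bigsetU (U : nat -> set X) n : (forall i, open (U i)) ->
  open_mass (\big[setU/set0]_(i < n) U i) <= \sum_(i < n) open_mass (U i).
Proof.
move=> Uo; elim: n => [|n IH]; first by rewrite !big_ord0 open_mass0.
rewrite !big_ord_recr /=; apply: le_trans (open_mass_setU _ _) _ => //.
  by rewrite -bigcup_mkord; apply: bigcup_open.
by rewrite lerD2r.
Qed.

(** The compact set of points of [C] where [f >= e / 2] meets the union in finitely many [U i] only,
    which reduces the claim to finite subadditivity. *)
Lemma open_mass_bigcup (U : nat -> set X) : (forall i, open (U i)) ->
  ((open_mass (\bigcup_i U i))%:E <= \sum_(i <oo) (open_mass (U i))%:E)%E.
Proof.
move=> Uo; apply/lee_addgt0Pr => e e0; set s := (\sum_(i <oo) _)%E.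
have s0 : (0 <= s)%E by apply: nneseries_ge0 => n _ _; rewrite lee_fin open_mass_ge0.
have [soo|sfin] := eqVneq s +oo%E; first by rewrite soo addye // leey.
have {}sfin : s \is a fin_num by rewrite fin_real // (lt_le_trans _ s0) // ltey.
rewrite -(fineK sfin) -EFinD lee_fin; apply: open_mass_le => f [Ef f01 fU].
have e20 : 0 < e / 2 by rewrite divr_gt0.
have [C Cc tC] := tight_compact lT e20.
pose D := C `&` [set x | e / 2 <= f x].
have : compact D by exact: compact_level.
rewrite compact_cover => /(_ nat setT U (fun i _ => Uo i))[|S _ DS].
  move=> x [_ /= fx]; apply: contrapT => /fU fx0.
  by move: fx; rewrite fx0 leNgt e20.
pose N := (\max_(i <- finmap.enum_fset S) i).+1.
have DN : D `<=` \big[setU/set0]_(i < N) U i.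
  move=> x /DS[i /= iS Uix]; rewrite -bigcup_mkord; exists i => //=.
  by rewrite ltnS; apply: leq_bigmax_seq.
have [||h ht h1] := @urysohn_compact D (\big[setU/set0]_(i < N) U i) _ _ DN.
- exact: compact_level.
- by rewrite -bigcup_mkord; apply: bigcup_open.
have [Eh h01 _] := ht.
have lfh : l f <= l h + e.
  have -> : e = 2 * (e / 2) by rewrite mulrC divfK.
  apply: (tight_approx (C := C)) => //.
  - by move=> x; have /andP[] := f01 x.
  - by move=> x; have /andP[] := h01 x.
  - exact: ltW.
  - move=> x Cx; have /andP[h0 _] := h01 x; have /andP[_ fx1] := f01 x.
    have [fx|fx] := leP (e / 2) (f x); last lra.
    by have := h1 x (conj Cx fx); lra.
apply: le_trans lfh _; rewrite lerD2r; apply: le_trans (open_mass_ub ht) _.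
apply: le_trans (open_mass_bigsetU _ Uo) _.
rewrite -lee_fin (fineK sfin) -sumEFin.
rewrite -(big_mkord xpredT (fun i => (open_mass (U i))%:E)).
by apply: nneseries_lim_ge => i _ _; rewrite lee_fin open_mass_ge0.
Qed.

(** With [f] almost optimal for the intersection of [V] and [U], take for [W] the part of [V] where
    [f < e / 2]. A test function of [W] and the positive part of [f - e / 2] are never both nonzero,
    so their sum is a test function of [V]. One half of [e] pays for the supremum, the other for the
    cut. *)
Lemma open_mass_split U V (e : R) : open U -> open V -> 0 < e ->
  exists W, [/\ open W, V `&` ~` U `<=` W &
    open_mass (V `&` U) + open_mass W <= open_mass V + e].
Proof.
move=> Uo Vo e0; have e20 : 0 < e / 2 by rewrite divr_gt0.
have [_ [f [Ef f01 fVU] <-] lf] := sup_adherent e20 (has_sup_mass (V `&` U)).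
rewrite -/(open_mass _) in lf.
exists (V `&` [set x | f x < e / 2]); split.
- apply: openI => //; apply: (open_comp _ (@open_lt _ (e / 2))).
  by move=> x _; exact: (lattice_continuous EL Ef).
- by move=> x [Vx nU]; split=> //=; rewrite fVU // => -[].
- suff : open_mass (V `&` [set x | f x < e / 2]) <= open_mass V + e / 2 - l f.
    by move: lf; lra.
  apply: open_mass_le => g [Eg g01 gW].
  pose f' := cst 0 \max (f - cst (e / 2)).
  have f'E x : f' x = Num.max 0 (f x - e / 2) by [].
  have Ecst := lattice_cst EL (e / 2).
  have Ef' : E f' by apply: (lattice_max EL); [exact: lattice_cst|exact: latticeB].
  have lf' : l f <= l f' + e / 2.
    rewrite -(tight_cst (e / 2)) -(tightD lT) //; apply: tight_le => //.
      exact: latticeD.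
    by move=> x; rewrite -[leRHS]/(f' x + e / 2) f'E -lerBlDr le_max lexx orbT.
  suff : l f' + l g <= open_mass V by lra.
  rewrite -(tightD lT) //; apply: open_mass_ub; split=> [|x|x nV].
  + exact: latticeD.
  + have /andP[? ?] := g01 x; have /andP[? ?] := f01 x.
    rewrite -[(f' + g) x]/(f' x + g x) f'E.
    have [fx|fx] := ltP (f x) (e / 2).
      by rewrite (max_idPl _) ?add0r ?g01 //; lra.
    rewrite gW; last by move=> [_ /=]; rewrite ltNge fx.
    by rewrite addr0 (max_idPr _); lra.
  + rewrite -[(f' + g) x]/(f' x + g x) f'E gW; last by move=> [].
    by rewrite addr0 (max_idPl _) // fVU; [lra|move=> []].
Qed.

(** * Outer mass and the measurability of open sets *)

Definition outer_mass (B : set X) : \bar R :=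
  ereal_inf [set (open_mass U)%:E | U in [set U | open U /\ B `<=` U]].

Lemma outer_mass_ge0 B : (0 <= outer_mass B)%E.
Proof.
by apply: le_ereal_inf_tmp => _ [U _ <-]; rewrite lee_fin open_mass_ge0.
Qed.

Lemma outer_mass_le_open B U : open U -> B `<=` U ->
  (outer_mass B <= (open_mass U)%:E)%E.
Proof. by move=> Uo BU; apply: ereal_inf_lbound; exists U. Qed.

Lemma outer_mass_le1 B : (outer_mass B <= 1)%E.
Proof.
by have := @outer_mass_le_open B setT openT (@subsetT _ _); rewrite open_massT.
Qed.

Lemma outer_mass_fin B : outer_mass B \is a fin_num.
Proof.
by rewrite ge0_fin_numE ?outer_mass_ge0// (le_lt_trans (outer_mass_le1 B))// ltry.
Qed.

Lemma outer_mass_open U : open U -> outer_mass U = (open_mass U)%:E.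
Proof.
move=> Uo; apply/eqP; rewrite eq_le outer_mass_le_open //=.
apply: le_ereal_inf_tmp => _ [V [_ UV] <-]; rewrite lee_fin.
exact: open_mass_mono.
Qed.

Lemma outer_mass_adherent B (e : R) : 0 < e ->
  exists U, [/\ open U, B `<=` U & ((open_mass U)%:E <= outer_mass B + e%:E)%E].
Proof.
move=> e0; have [_ [U [Uo BU] <-] h] := lb_ereal_inf_adherent e0 (outer_mass_fin B).
by exists U; split=> //; exact: ltW.
Qed.

Lemma outer_mass_mono A B : A `<=` B -> (outer_mass A <= outer_mass B)%E.
Proof.
move=> AB; apply: le_ereal_inf_tmp => _ [U [Uo BU] <-].
by apply: outer_mass_le_open => //; exact: subset_trans BU.
Qed.

Lemma outer_mass_sigma_subadditive : sigma_subadditive outer_mass.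
Proof.
move=> F; apply/lee_addgt0Pr => e e0.
apply: le_trans (epsilon_trick _ _ (ltW e0)); last by move=> n; exact: outer_mass_ge0.
have en0 n : 0 < e / (2 ^ n.+1)%:R by rewrite divr_gt0 // ltr0n expn_gt0.
have [U UP] := choice (fun n => outer_mass_adherent (F n) (en0 n)).
have Uo n : open (U n) by have [] := UP n.
apply: (@le_trans _ _ (open_mass (\bigcup_n U n))%:E).
  apply: outer_mass_le_open; first exact: bigcup_open.
  by apply: subset_bigcup => n _; have [] := UP n.
apply: le_trans (open_mass_bigcup Uo) _; apply: lee_nneseries => n _.
  by rewrite lee_fin open_mass_ge0.
by have [] := UP n.
Qed.

Lemma outer_mass_caratheodory U V : open U ->
  (outer_mass (V `&` U) + outer_mass (V `&` ~` U) <= outer_mass V)%E.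
Proof.
move=> Uo; apply: le_ereal_inf_tmp => _ [V' [V'o VV'] <-].
apply/lee_addgt0Pr => e e0.
have [W [Wo VW h]] := open_mass_split Uo V'o e0.
apply: (@le_trans _ _ (open_mass (V' `&` U) + open_mass W)%:E); last first.
  by rewrite -EFinD lee_fin.
rewrite EFinD; apply: leeD; apply: outer_mass_le_open => //.
- exact: openI.
- exact: setSI.
- by apply: subset_trans VW; exact: setSI.
Qed.

(** The measure is the outer mass itself as a function on all subsets, which is why the equality is
    stated for arbitrary [B]; the Borel sets enter through sigma-additivity. *)
Lemma outer_mass_measure : exists nu : {measure set (borel_space X) -> \bar R},
  forall B : set X, nu B = outer_mass B.
Proof.
have out0 : outer_mass set0 = 0%E.
  by rewrite outer_mass_open ?open_mass0 //; exact: open0.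
pose mu : {outer_measure set X -> \bar R} := HB.pack outer_mass
  (isOuterMeasure.Build R X outer_mass out0 outer_mass_ge0 outer_mass_mono
     outer_mass_sigma_subadditive).
have sub : <<s @open X >> `<=` mu.-caratheodory.
  apply: smallest_sub.
    split=> [|B mB|F mF].
    - exact: caratheodory_measurable_set0.
    - by rewrite setTD; exact: caratheodory_measurable_setC.
    - exact: caratheodory_measurable_bigcup.
  move=> U Uo; apply: le_caratheodory_measurable => V.
  exact: outer_mass_caratheodory.
have sadd : semi_sigma_additive (outer_mass : set (borel_space X) -> \bar R).
  move=> F mF tF mUF; apply: (@caratheodory_measure_sigma_additive R X mu) => //.
    by move=> i; exact: (sub _ (mF i)).
  exact: (sub _ mUF).
pose nu : {measure set (borel_space X) -> \bar R} :=
  HB.pack (outer_mass : set (borel_space X) -> \bar R)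
    (isMeasure.Build _ (borel_space X) R
      (outer_mass : set (borel_space X) -> \bar R) out0 outer_mass_ge0 sadd).
by exists nu.
Qed.

Lemma lattice_norm_bounded f : E f -> exists c, forall x, `|f x| <= c.
Proof.
move=> Ef; have [c fc] := lattice_bounded EL Ef.
have [d fd] := lattice_bounded EL (latticeN Ef).
exists (Num.max c d) => x; rewrite ler_norml lerNl !le_max.
by have := fc x; have := fd x => /= -> ->; rewrite orbT.
Qed.

(** * Integrals against the outer mass and inner regularity *)

Section Measure.
Context (nu : {measure set (borel_space X) -> \bar R}).
Context (nuE : forall B : set X, nu B = outer_mass B).

Lemma mass_fin : (nu setT < +oo)%E.
Proof. by rewrite nuE (le_lt_trans (outer_mass_le1 _)) // ltry. Qed.

Lemma lattice_integrable f : E f -> nu.-integrable setT (EFin \o f).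
Proof.
move=> Ef; have [c fc] := lattice_norm_bounded Ef.
apply: bounded_continuous_integrable fc; first exact: mass_fin.
exact: (lattice_continuous EL).
Qed.

(* The first summand is at most 1, so applying this to large multiples of [f]
   removes it. *)
Lemma tight_le_integral_add f n : E f -> (forall x, 0 <= f x <= n%:R) ->
  l f <= open_mass [set x | 0 < f x] + \int[nu]_x f x.
Proof.
have open_pos g : E g -> open [set x | 0 < g x].
  move=> Eg; apply: (open_comp _ (@open_gt _ 0)).
  by move=> x _; exact: (lattice_continuous EL Eg).
elim: n f => [|n IH] f Ef f0n.
  have -> : f = cst 0.
    by apply/funext => x /=; apply/eqP; rewrite eq_le andbC; exact: f0n.
  by rewrite tight_cst Rintegral_cst // mul0r addr0 open_mass_ge0.
(* A telescoping layer decomposition: [f1] is the minimum of 1 and [f], and [f2] the rest. The value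
   [l f1] is charged to the mass of the set [f > 0]; the mass of [f2 > 0], left over by the
   induction, is charged to the integral of [f1], which equals 1 there. *)
pose f1 := clamp f; pose f2 := cst 0 \max (f - cst 1).
have f1E x : f1 x = Num.max 0 (Num.min 1 (f x)) by [].
have f2E x : f2 x = Num.max 0 (f x - 1) by [].
have E1 : E f1 by exact: lattice_clamp.
have E2 : E f2.
  apply: (lattice_max EL); first exact: lattice_cst.
  by apply: latticeB => //; exact: lattice_cst.
have fE x : f x = f1 x + f2 x.
  have /andP[fx0 _] := f0n x; rewrite f1E f2E.
  have [fx|fx] := leP (f x) 1.
    by rewrite (max_idPr fx0) (max_idPl _) ?addr0 // subr_le0.
  by rewrite (max_idPr ler01) (max_idPr _) ?subr_ge0 ?ltW //; lra.
have lf1 : l f1 <= open_mass [set x | 0 < f x].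
  apply: open_mass_ub; apply: test_clamp => // x /= /negP.
  by rewrite -leNgt.
have lf2 : l f2 <= open_mass [set x | 0 < f2 x] + \int[nu]_x f2 x.
  apply: IH => // x; have /andP[fx0 fxn] := f0n x.
  rewrite f2E le_max lexx ge_max ler0n /=.
  by rewrite lerBlDr natr1.
have mf2 : open_mass [set x | 0 < f2 x] <= \int[nu]_x f1 x.
  have Uo := open_pos _ E2.
  rewrite -lee_fin -outer_mass_open // -nuE.
  rewrite -(setIT [set x | _]) -(integral_indic nu measurableT (borel_open Uo)).
  rewrite /Rintegral fineK; last first.
    by apply: integrable_fin_num => //; exact: lattice_integrable.
  apply: ge0_le_integral => //.
  - by apply/measurable_EFinP; apply: measurable_indic; exact: borel_open.
  - by apply/measurable_EFinP; apply: measurable_continuous;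
      exact: (lattice_continuous EL).
  - move=> x _; rewrite lee_fin indicE; have /andP[f10 _] := clamp_itv f x.
    have [fx|fx] := boolP (x \in _); last exact: f10.
    move: fx; rewrite inE /= f2E f1E lt_max ltxx /= subr_gt0 => fx.
    by rewrite (min_idPl (ltW fx)) le_max lexx orbT.
have -> : \int[nu]_x f x = \int[nu]_x f1 x + \int[nu]_x f2 x.
  rewrite -RintegralD //; try exact: lattice_integrable.
  by apply: eq_Rintegral => x _; rewrite fE.
have -> : l f = l f1 + l f2.
  by rewrite -(tightD lT) //; congr l; apply/funext => x; rewrite fE.
lra.
Qed.

Lemma tight_le_integral f : E f -> (forall x, 0 <= f x) ->
  l f <= \int[nu]_x f x.
Proof.
move=> Ef f0; apply/ler_addgt0Pr => e e0; have [c fc] := lattice_bounded EL Ef.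
have e'0 : 0 < e^-1 by rewrite invr_gt0.
have Etf := latticeZ EL e^-1 Ef.
have [n ng] : exists n, e^-1 * c < n%:R.
  by exists (Num.truncn (e^-1 * c)).+1; exact: truncnS_gt.
have : l (e^-1 *: f) <= open_mass [set x | 0 < (e^-1 *: f) x] +
    \int[nu]_x (e^-1 *: f) x.
  apply: (tight_le_integral_add (n := n)) => // x.
  rewrite -[(e^-1 *: f) x]/(e^-1 * f x) mulr_ge0 ?f0 ?(ltW e'0) //=.
  by apply: le_trans (ltW ng); rewrite ler_pM2l.
rewrite (tightZ lT) // RintegralZl //; last exact: lattice_integrable.
move=> h; have : e^-1 * l f <= 1 + e^-1 * \int[nu]_x f x.
  apply: le_trans h _; rewrite lerD2r -open_massT; exact: open_mass_mono.
by rewrite -ler_pdivlMl // invrK mulrDr mulr1 mulrA mulfV ?gt_eqF // mul1r addrC.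
Qed.

(** The previous inequality for [c - g >= 0] reverses to an upper bound for the integral of [g],
    since [l] and [nu] agree on constants; passing to [- f] gives equality. *)
Lemma tight_integral f : E f -> \int[nu]_x f x = l f.
Proof.
suff le g : E g -> \int[nu]_x g x <= l g.
  move=> Ef; apply/eqP; rewrite eq_le le //=.
  have := le _ (latticeN Ef); rewrite tightN //.
  have -> : \int[nu]_x (- f) x = - \int[nu]_x f x.
    transitivity (\int[nu]_x (-1 * f x)).
      by apply: eq_Rintegral => x _; rewrite mulN1r.
    by rewrite RintegralZl ?mulN1r //; exact: lattice_integrable.
  by rewrite lerN2.
move=> Eg; have [c gc] := lattice_bounded EL Eg.
have Ec := lattice_cst EL c.
have : l (cst c - g) <= \int[nu]_x (cst c - g) x.
  by apply: tight_le_integral; [exact: latticeB|move=> x; rewrite fctE subr_ge0].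
rewrite tightB // tight_cst RintegralB //; try exact: lattice_integrable.
rewrite Rintegral_cst // nuE outer_mass_open; last exact: openT.
by rewrite open_massT mulr1 lerD2l lerN2.
Qed.

(** Inner regularity is outer regularity of the complement combined with tightness: if [U] is an
    open set slightly larger than the complement of [B], then [C] minus [U] is a compact subset of
    [B], and it misses only points outside [C] or in both [U] and [B]. *)
Lemma tight_radon : hausdorff_space X -> radon nu.
Proof.
move=> hX; have oX := @openT X.
split=> [x|B mB]; first by exists setT; split=> //; exact: mass_fin.
apply/eqP; rewrite eq_le; apply/andP; split; last first.
  apply: ge_ereal_sup => _ [C [Cc CB] <-].
  apply: le_measure => //; rewrite inE //; apply: borel_closed.
  exact: compact_closed.
apply/lee_addgt0Pr => e e0; have e20 : 0 < e / 2 by rewrite divr_gt0.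
have [U [Uo BU hU]] := outer_mass_adherent (~` B) e20.
have [C Cc tC] := tight_compact lT e20.
have Ccl : closed C by exact: compact_closed.
have nC : (nu (~` C) <= (e / 2)%:E)%E.
  rewrite nuE outer_mass_open ?openC // lee_fin.
  by apply: open_mass_le => f [Ef f01 fC]; apply: tC => // x Cx; exact: fC.
pose F := C `&` ~` U.
have Fc : compact F by apply: compact_closedI => //; rewrite closedC.
have FB : F `<=` B by move=> x [_ nU]; apply: contrapT => nB; apply: nU; exact: BU.
have mF : measurable (F : set (borel_space X)).
  by apply: borel_closed; exact: compact_closed.
have mU := borel_open Uo; have mnB := measurableC mB.
have nUB : (nu (U `&` B) <= (e / 2)%:E)%E.
  move: hU; rewrite -outer_mass_open // -!nuE (measureDI nu mU mnB).
  rewrite setDE setCK (setIidr BU) addeC leeD2lE //.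
  by have := outer_mass_fin (~` B); rewrite -nuE.
apply: le_trans (_ : (nu F + (nu (~` C) + nu (U `&` B)) <= _)%E).
  apply: (@le_trans _ _ (nu (F `|` (~` C `|` (U `&` B))))).
    apply: le_measure; rewrite ?inE //.
      apply: measurableU => //; apply: measurableU; last exact: measurableI.
      by apply: borel_open; rewrite openC.
    move=> x Bx; have [Cx|nC'] := pselect (C x); last by right; left.
    by have [Ux|nU] := pselect (U x); [right; right|left].
  apply: le_trans (measureU2 _ _ _) _ => //.
    by apply: measurableU; [apply: borel_open; rewrite openC|exact: measurableI].
  apply: leeD => //; apply: measureU2; last exact: measurableI.
  by apply: borel_open; rewrite openC.
rewrite (splitr e) EFinD; apply: leeD; last exact: leeD.
by apply: ereal_sup_ubound; exists F.
Qed.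
End Measure.

(** The last clause keeps the description of open masses visible; with [c = 0] it later shows that
    the complement of [K] is a null set. *)
Theorem tight_functional_measure : hausdorff_space X ->
  exists nu : {measure set (borel_space X) -> \bar R},
    [/\ radon nu, nu setT = 1%E,
        forall f, E f -> (\int[nu]_x (f x)%:E = (l f)%:E)%E
      & forall U (c : R), open U ->
          (forall f, test_function U f -> l f <= c) -> (nu U <= c%:E)%E].
Proof.
move=> hX; have [nu nuE] := outer_mass_measure; exists nu; split.
- exact: tight_radon.
- by rewrite nuE outer_mass_open ?open_massT //; exact: openT.
- move=> f Ef; rewrite -(tight_integral nuE Ef) /Rintegral fineK //.
  by apply: integrable_fin_num => //; exact: lattice_integrable.
- by move=> U c Uo h; rewrite nuE outer_mass_open // lee_fin; exact: open_mass_le.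
Qed.

End TightFunctionals.

(** * Measures on character spaces *)

Lemma continuous_maxr (R : realType) (X : topologicalType) (f g : X -> R) :
  continuous f -> continuous g -> continuous (f \max g).
Proof.
move=> fc gc x; have -> : f \max g = fun y => 2^-1 * (f y + g y + `|f y - g y|).
  by apply/funext => y; rewrite mulrC /= maxr_absE.
apply: cvgMl_tmp; apply: cvgD; first by apply: cvgD; [exact: fc|exact: gc].
by apply: cvg_norm; apply: cvgB; [exact: fc|exact: gc].
Qed.

Section Characters.
Context (R : realType) (B : charAlgType R).
Implicit Types (a b : B) (x y : char_space B).

Lemma char_evalN a x : char_eval (- a) x = - char_eval a x.
Proof. by rewrite /char_eval raddfN. Qed.

Lemma char_evalZ (c : R) a x : char_eval (c *: a) x = c * char_eval a x.
Proof. by rewrite /char_eval linearZ. Qed.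

Lemma char_eval0 x : char_eval (0 : B) x = 0.
Proof. by rewrite /char_eval raddf0. Qed.

(** The complement of [U] is the nonnegativity set of some [Q], and [x] violates one of these
    inequalities; the negative of that element separates. *)
Lemma char_separates (U : set (char_space B)) x : open U -> U x ->
  exists a, 0 < char_eval a x /\ forall y, ~ U y -> char_eval a y <= 0.
Proof.
move=> Uo Ux; have /closed_char_spaceP[Q _ UQ] : closed (~` U) by rewrite closedC.
have : ~ nonneg_set Q x by rewrite -UQ.
move/existsNP => [a /not_implyP[Qa /negP]]; rewrite -ltNge => ax.
exists (- a); split=> [|y nUy]; first by rewrite char_evalN oppr_gt0.
have : nonneg_set Q y by rewrite -UQ.
by move=> /(_ a Qa); rewrite char_evalN oppr_le0.
Qed.

Definition bcont (f : char_space B -> R) :=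
  continuous f /\ exists c, forall x, `|f x| <= c.

Definition truncated (t : R) a : char_space B -> R :=
  cst (- t) \max (cst t \min char_eval a).

Lemma truncatedE t a x :
  truncated t a x = Num.max (- t) (Num.min t (char_eval a x)).
Proof. by []. Qed.

Lemma bcont_cst (c : R) : bcont (cst c).
Proof. by split; [exact: cst_continuous|exists `|c|]. Qed.

Lemma bcontD f g : bcont f -> bcont g -> bcont (f + g).
Proof.
move=> [fc [c fb]] [gc [d gb]]; split.
  by move=> x; exact: (cvgD (fc x) (gc x)).
exists (c + d) => x; apply: le_trans (ler_normD _ _) _.
by apply: lerD; [exact: fb|exact: gb].
Qed.

Lemma bcontZ (c : R) f : bcont f -> bcont (c *: f).
Proof.
move=> [fc [d fb]]; split; first by move=> x; exact: (cvgMl_tmp (a := c) (fc x)).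
exists (`|c| * d) => x; rewrite -[(c *: f) x]/(c * f x) normrM.
by apply: ler_wpM2l.
Qed.

Lemma bcont_max f g : bcont f -> bcont g -> bcont (f \max g).
Proof.
move=> [fc [c fb]] [gc [d gb]]; split; first exact: continuous_maxr.
exists (Num.max c d) => x /=; rewrite le_max.
by case: (leP (f x) (g x)) => _; rewrite ?fb ?gb ?orbT.
Qed.

Lemma bcont_truncated t a : bcont (truncated t a).
Proof.
split.
  apply: continuous_maxr; first exact: cst_continuous.
  have -> : cst t \min char_eval a = - (cst (- t) \max (char_eval (- a))).
    by apply/funext => x /=; rewrite fctE /= oppr_max char_evalN !opprK.
  have h : continuous (cst (- t) \max (char_eval (- a))).
    by apply: continuous_maxr; [exact: cst_continuous|exact: char_eval_continuous].
  by move=> x; exact: (cvgN (h x)).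
exists `|t| => x; rewrite truncatedE ler_norml le_max ge_max ge_min.
by rewrite lerN2 !ler_norm /= andbT ler_normr lexx orbT.
Qed.

Lemma bcont_lattice : function_lattice bcont.
Proof.
split.
- by move=> f [].
- by move=> f [_ [c fb]]; exists c => x; apply: le_trans (ler_norm _) (fb x).
- exact: bcont_cst.
- exact: bcontD.
- exact: bcontZ.
- exact: bcont_max.
- move=> U x Uo Ux; have [a [ax aU]] := char_separates Uo Ux.
  exists (truncated 1 a); split=> [||y /aU ay]; first exact: bcont_truncated.
    by rewrite truncatedE !lt_max lt_min ltr01 ax orbT.
  by rewrite truncatedE ge_max ge_min ay orbT andbT lerNl oppr0 ler01.
Qed.

End Characters.

(** * Representing measures from dominated tight functionals *)

Section RepresentingFromTight.
Context (R : realType) (B : charAlgType R) (L : {scalar B}).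
Context (K : set (char_space B)) (E : set (char_space B -> R)).
Context (l : (char_space B -> R) -> R).
Context (L1 : L 1 = 1) (Kcl : closed K) (EL : function_lattice E).
Context (Etrunc : forall t a, E (truncated t a)).
Context (lD : forall f g, E f -> E g -> l (f + g) = l f + l g).
Context (lZ : forall (c : R) f, E f -> l (c *: f) = c * l f).
Context (l_dom : forall f a, E f ->
  (forall x, K x -> f x <= char_eval a x) -> l f <= L a).
Context (l_tight : forall e : R, 0 < e -> exists2 C, compact C &
  forall f, E f -> (forall x, 0 <= f x <= 1) ->
    (forall x, C x -> f x = 0) -> l f <= e).

(** Domination by the elements 0, 1 and -1 of the algebra gives positivity and the value 1 at the
    constant 1. *)
Lemma dominated_tight_functional : tight_functional E l.
Proof.
have lN f : E f -> l (- f) = - l f.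
  by move=> Ef; rewrite -scaleN1r lZ // mulN1r.
split=> // [f Ef f0|].
  rewrite -oppr_le0 -lN // -(raddf0 L); apply: l_dom => [|x _].
    exact: (latticeN EL).
  by rewrite char_eval0 oppr_le0.
have E1 := lattice_cst EL 1; apply/eqP; rewrite eq_le; apply/andP; split.
  have : l (cst 1) <= L 1 by apply: l_dom => // x _; rewrite char_eval1.
  by rewrite L1.
have : l (- cst 1) <= L (- 1).
  apply: l_dom => [|x _]; first exact: (latticeN EL).
  by rewrite char_evalN char_eval1.
by rewrite lN // raddfN /= L1 lerN2.
Qed.

Lemma dominated_sqr_ge0 a : 0 <= L (a ^+ 2).
Proof.
have <- : l (cst 0) = 0.
  by rewrite (_ : cst 0 = 0 *: cst 0) ?lZ ?mul0r ?scaler0 //; exact: lattice_cst.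
apply: l_dom => [|x _]; first exact: (lattice_cst EL).
by rewrite char_evalX sqr_ge0.
Qed.

Lemma truncated_le (t : R) (a : B) x : 0 < t ->
  char_eval a x <= truncated t a x + t^-1 * char_eval (a ^+ 2) x /\
  truncated t a x <= char_eval a x + t^-1 * char_eval (a ^+ 2) x.
Proof.
move=> t0; rewrite truncatedE char_evalX; set r := char_eval a x.
have h : t * (t^-1 * r ^+ 2) = r ^+ 2 by rewrite mulrA mulfV ?gt_eqF // mul1r.
have h0 : 0 <= t^-1 * r ^+ 2 by rewrite mulr_ge0 ?sqr_ge0 // invr_ge0 ltW.
have [rt|rt] := leP t r.
  by rewrite (max_idPr _); [split; nra|lra].
have [rt'|rt'] := leP (- t) r; first by split; lra.
by split; nra.
Qed.

Theorem representing_of_dominated :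
  exists nu : {measure set (borel_space (char_space B)) -> \bar R},
    radon_representing L K nu.
Proof.
have lT := dominated_tight_functional.
have [nu [nur nu1 nuE nuU]] :=
  tight_functional_measure EL lT (@char_space_hausdorff R B).
have nufin : (nu setT < +oo)%E by rewrite nu1 ltry.
exists nu; split=> //; split.
- exact: borel_closed.
(* A test function of the complement of [K] vanishes on [K], where it is therefore dominated by the
   element 0. *)
- apply/eqP; rewrite eq_le measure_ge0 andbT; apply: nuU; first by rewrite openC.
  move=> f [Ef f01 fK]; rewrite -(raddf0 L); apply: l_dom => // x Kx.
  by rewrite char_eval0 fK //; exact.
have mev a : measurable_fun [set: borel_space (char_space B)] (char_eval a).
  by apply: measurable_continuous; exact: char_eval_continuous.
(* Monotone convergence along the truncations at level [n]: each is dominated by [a ^+ 2], so its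
   integral is at most [L (a ^+ 2)]. The finite second moment makes [a] integrable, its absolute
   value being at most [1 + a ^+ 2]. *)
have sqr a : (\int[nu]_x (char_eval (a ^+ 2) x)%:E <= (L (a ^+ 2))%:E)%E.
  pose g n x : \bar R := (truncated n%:R (a ^+ 2) x)%:E.
  have gE n x : g n x = (Num.min n%:R (char_eval (a ^+ 2) x))%:E.
    rewrite /g truncatedE (max_idPr _) // le_min char_evalX.
    rewrite (le_trans _ (ler0n _ n)) ?oppr_le0 ?ler0n //=.
    by rewrite (le_trans _ (sqr_ge0 _)) // oppr_le0.
  have gmono x : {homo g^~ x : n m / (n <= m)%N >-> (n <= m)%E}.
    move=> n m nm; rewrite !gE lee_fin le_min !ge_min lexx orbT andbT.
    by rewrite ler_nat nm.
  have glim x : limn (g^~ x) = (char_eval (a ^+ 2) x)%:E.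
    apply: lim_near_cst => //; near=> n; rewrite gE (min_idPr _) //.
    near: n; exact: nbhs_infty_ger.
  have mg n : measurable_fun [set: borel_space (char_space B)] (g n).
    apply/measurable_EFinP; apply: measurable_continuous.
    by have [] := bcont_truncated n%:R (a ^+ 2).
  have g0 n (x : borel_space (char_space B)) : setT x -> (0 <= g n x)%E.
    by move=> _; rewrite gE lee_fin le_min ler0n char_evalX sqr_ge0.
  have := @cvg_monotone_convergence _ _ _ nu _ measurableT g mg g0 (fun x _ => gmono x).
  under eq_integral do rewrite glim.
  move=> cv; rewrite -(cvg_lim _ cv) //; apply: lime_le.
    by apply/cvg_ex; eexists; exact: cv.
  apply: nearW => n; rewrite nuE // lee_fin; apply: l_dom => // x _.
  by rewrite -lee_fin -/(g n x) gE lee_fin ge_min lexx orbT.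
have int_sqr a : nu.-integrable setT (fun x => (char_eval (a ^+ 2) x)%:E).
  apply/integrableP; split; first exact/measurable_EFinP.
  under eq_integral do rewrite gee0_abs ?lee_fin ?char_evalX ?sqr_ge0 //=.
  under eq_integral do rewrite -char_evalX.
  by apply: le_lt_trans (sqr a) _; exact: ltry.
have int a : nu.-integrable setT (fun x => (char_eval a x)%:E).
  apply: (@le_integrable _ _ _ nu _ measurableT _
    (fun x => (1 + char_eval (a ^+ 2) x)%:E)).
  - exact/measurable_EFinP.
  - move=> x _; rewrite !abse_EFin lee_fin char_evalX ler_norml.
    have := sqr_ge0 (char_eval a x) => h.
    by rewrite ger0_norm ?addr_ge0 //; apply/andP; split; nra.
  - have -> : (fun x => (1 + char_eval (a ^+ 2) x)%:E) =
        (fun x : borel_space _ => (1%:E + (char_eval (a ^+ 2) x)%:E)%E) by [].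
    apply: integrableD => //.
    by apply: (@bounded_continuous_integrable _ _ nu (cst 1) `|1|) => //;
      exact: cst_continuous.
have tint t a : nu.-integrable setT (EFin \o truncated t a).
  by have [? [c ?]] := bcont_truncated t a; exact: bounded_continuous_integrable.
suff le a : \int[nu]_x char_eval a x <= L a.
  move=> a; split; first exact: int.
  rewrite -[RHS]fineK; last exact: integrable_fin_num.
  congr EFin; apply/eqP; rewrite eq_le (le a) andbT.
  have := le (- a); rewrite raddfN /= => h; rewrite -lerN2; apply: le_trans h.
  suff -> : \int[nu]_x char_eval (- a) x = - \int[nu]_x char_eval a x by [].
  transitivity (\int[nu]_x (-1 * char_eval a x)).
    by apply: eq_Rintegral => x _; rewrite char_evalN mulN1r.
  by rewrite RintegralZl ?mulN1r //; exact: int.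
apply/ler_addgt0Pr => e e0; set c := L (a ^+ 2).
have c0 : 0 <= c := dominated_sqr_ge0 a.
(* The error [c / t] occurs twice, once under the integral and once under [l], so [t] is chosen with
   [2 * c / t <= e]; the summand 1 keeps it positive when [c = 0]. *)
pose t := 2 * c / e + 1.
have t0 : 0 < t by rewrite ltr_wpDl // divr_ge0 ?(ltW e0) // mulr_ge0.
have lt : l (truncated t a) <= L a + t^-1 * c.
  rewrite -linearZ -raddfD; apply: l_dom => // x _.
  by rewrite char_evalD char_evalZ; have [] := truncated_le a x t0.
have isqr : nu.-integrable setT (fun x => (t^-1 * char_eval (a ^+ 2) x)%:E).
  exact: (integrableZl measurableT t^-1 (int_sqr a)).
apply: (@le_trans _ _ (\int[nu]_x (truncated t a x + t^-1 * char_eval (a ^+ 2) x))).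
  apply: (le_Rintegral measurableT (int a)).
    exact: (integrableD measurableT (tint t a) isqr).
  by move=> x _; have [] := truncated_le a x t0.
rewrite (RintegralD measurableT (tint t a) isqr).
rewrite (RintegralZl _ measurableT (int_sqr a)).
have h1 : \int[nu]_x truncated t a x = l (truncated t a).
  by rewrite /Rintegral nuE.
have h2 : \int[nu]_x char_eval (a ^+ 2) x <= c.
  have := sqr a; rewrite /Rintegral -lee_fin fineK //.
  exact: integrable_fin_num.
have h3 : t^-1 * \int[nu]_x char_eval (a ^+ 2) x <= t^-1 * c.
  by rewrite ler_wpM2l // invr_ge0 ltW.
have h4 : 2 * (t^-1 * c) <= e.
  have te : 2 * c <= t * e.
    by rewrite [t * e]mulrDl mul1r divfK ?gt_eqF // lerDl ltW.
  by rewrite mulrCA ler_pdivrMl.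
rewrite h1; lra.
Unshelve. all: by end_near.
Qed.

End RepresentingFromTight.

(** * Convergence and compactness in character spaces *)

Section CharTopology.
Context (R : realType) (B : charAlgType R).

Lemma char_cvg (F : set_system (char_space B)) (x : char_space B) : Filter F ->
  (forall a, char_eval a @ F --> char_eval a x) -> F --> x.
Proof.
move=> FF h; apply/cvg_sup => a U; rewrite nbhsE => -[V [[W Wo WV] Vx] VU].
apply: filterS VU _; rewrite -WV; apply: (h a); apply: open_nbhs_nbhs; split=> //.
by move: Vx; rewrite -WV.
Qed.

Lemma continuous_to_char (Y : topologicalType) (f : Y -> char_space B) :
  (forall a, continuous (char_eval a \o f)) -> continuous f.
Proof. by move=> fc y; apply: char_cvg => a; exact: fc. Qed.

(** Along an ultrafilter on the box every evaluation converges, by compactness of segments. The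
    limits are again linear, multiplicative and unital in the element, so they form a character of
    the box. These boxes furnish the compact sets for tightness over the X(T). *)
Lemma compact_char_box (r : B -> R) :
  compact [set x : char_space B | forall a, `|char_eval a x| <= r a].
Proof.
rewrite compact_ultra => F FU FC; have FF : ProperFilter F by exact: ultra_proper.
have cl a : exists v, `|v| <= r a /\ char_eval a @ F --> v.
  have FI : F (char_eval a @^-1` `[- r a, r a]%classic).
    apply: (filterS _ FC) => x xa.
    by rewrite /preimage /= in_itv /= -ler_norml; exact: xa.
  have [v [vI vF]] := segment_compact (fmap_proper_filter (char_eval a) FF) FI.
  exists v; split; first by move: vI; rewrite /= in_itv /= -ler_norml.
  move=> W Wv; have [//|nW] := in_ultra_setVsetC (char_eval a @^-1` W) FU.
  exfalso; have [z [/= zn zW]] := vF (~` W) W nW Wv.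
  exact: zn.
have [v vP] := choice cl.
have vcv a : char_eval a @ F --> v a by have [] := vP a.
have vlim a (w : R) : char_eval a @ F --> w -> v a = w.
  by apply: (@cvg_unique _ (@Rhausdorff R)); exact: vcv.
have vlin : linear_for *%R v.
  move=> c a b; apply: vlim.
  have -> : char_eval (c *: a + b) = fun x => c * char_eval a x + char_eval b x.
    by apply/funext => x; rewrite char_evalD char_evalZ.
  exact: (cvgD (cvgMl_tmp (vcv a)) (vcv b)).
have vmul : monoid_morphism v.
  split=> [|a b]; apply: vlim.
    have -> : char_eval (1 : B) = cst 1 by apply/funext => x; rewrite char_eval1.
    exact: cvg_cst.
  have -> : char_eval (a * b) = char_eval a \* char_eval b.
    by apply/funext => x; rewrite char_evalM.
  exact: (cvgM (vcv a) (vcv b)).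
pose chi : {lrmorphism B -> R | *%R} := HB.pack v
  (GRing.isLinear.Build R B R *%R v vlin) (GRing.isMonoidMorphism.Build B R v vmul).
exists (chi : char_space B); split; first by move=> a; have [] := vP a.
by apply: char_cvg => a; exact: vcv.
Qed.

End CharTopology.

(** * Generated subalgebras and the directedness of I and Lambda *)

Section GeneratedSubalgebras.
Context (R : realType) (A : charAlgType R).
Implicit Types (S T : subalgClosed A) (G : set A).

Lemma subalg_ofP (P : A -> Prop) : P 1 ->
  (forall (c : R) a b, P a -> P b -> P (c *: a + b)) ->
  (forall a b, P a -> P b -> P (a * b)) ->
  exists S, forall a, a \in S <-> P a.
Proof.
move=> P1 Plin Pmul; pose Q : A -> bool := fun a => `[< P a >].
have QP : GRing.subalg_closed Q.
  split.
  - exact/asboolP.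
  - by move=> c a b /asboolP Pa /asboolP Pb; apply/asboolP; exact: Plin.
  - by move=> a b /asboolP Pa /asboolP Pb; apply/asboolP; exact: Pmul.
pose S : subalgClosed A := HB.pack Q
  (GRing.isSubalgClosed.Build R A Q (GRing.subalg_closed_semi QP)).
by exists S => a; split=> [/asboolP|Pa]; last exact/asboolP.
Qed.

Lemma subalg_generated_exists G : exists S, subalg_generated S G.
Proof.
have [|||S SP] := @subalg_ofP (fun a => forall T, G `<=` [set` T] -> a \in T).
- by move=> T _; exact: rpred1.
- by move=> c a b Pa Pb T GT; rewrite rpredD ?rpredZ ?Pa ?Pb.
- by move=> a b Pa Pb T GT; rewrite rpredM ?Pa ?Pb.
exists S; split=> [a Ga|T GT a /SP]; last exact.
by apply/SP => T; exact.
Qed.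

Lemma subalg_ind S G (P : subalg S -> Prop) : subalg_generated S G ->
  (forall s, G (val s) -> P s) -> P 1 ->
  (forall (c : R) s t, P s -> P t -> P (c *: s + t)) ->
  (forall s t, P s -> P t -> P (s * t)) -> forall s, P s.
Proof.
move=> [GS Smin] PG P1 Plin Pmul.
have [|||T TP] := @subalg_ofP (fun a => exists2 s : subalg S, val s = a & P s).
- by exists 1.
- by move=> c _ _ [s <- Ps] [t <- Pt]; exists (c *: s + t) => //; exact: Plin.
- by move=> _ _ [s <- Ps] [t <- Pt]; exists (s * t) => //; exact: Pmul.
have ST : {subset S <= T}.
  apply: Smin => a Ga; apply/TP; exists (Sub a (GS a Ga)); first exact: SubK.
  by apply: PG; rewrite SubK.
by move=> s; have /TP[t /val_inj <-] := ST _ (valP s).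
Qed.

Lemma count_gen_enum T : count_gen T ->
  exists e : nat -> subalg T, subalg_generated T (range (val \o e)).
Proof.
move=> [G /countable_injP[f finj] [GT Tmin]].
have code n : exists s : subalg T, forall a, G a -> f a = n -> val s = a.
  have [[a [Ga fa]]|nG] := pselect (exists a, G a /\ f a = n).
    exists (Sub a (GT a Ga)) => b Gb fb; rewrite SubK.
    by apply: finj; rewrite ?inE // fa fb.
  (* Codes of no generator are sent to 1, which lies in every subalgebra and so does not change what
     is generated. *)
  by exists 1 => a Ga fa; exfalso; apply: nG; exists a.
have [e eP] := choice code; exists e; split.
  by move=> _ [n _ <-]; exact: valP.
move=> S eS; apply: Tmin => a Ga; apply: eS; exists (f a) => //=.
exact: eP.
Qed.

Lemma fin_gen_count_gen S : fin_gen S -> count_gen S.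
Proof. by move=> [G Gfin SG]; exists G => //; exact: finite_set_countable. Qed.

Lemma subalg_generated_sub S T G H : subalg_generated S G ->
  subalg_generated T H -> G `<=` H -> {subset S <= T}.
Proof. by move=> [_ Smin] [HT _] GH; apply: Smin; exact: subset_trans HT. Qed.

(** The last clause keeps the join inside a given [T], as is required to intersect two cylinders of
    X(T) with bases over [S] and [S']. *)
Lemma fin_gen_join S S' : fin_gen S -> fin_gen S' ->
  exists S'', [/\ fin_gen S'', {subset S <= S''}, {subset S' <= S''} &
    forall T, {subset S <= T} -> {subset S' <= T} -> {subset S'' <= T}].
Proof.
move=> [G Gfin SG] [G' G'fin SG'].
have [S'' S''G] := subalg_generated_exists (G `|` G'); exists S''; split.
- by exists (G `|` G') => //; rewrite finite_setU.
- by apply: subalg_generated_sub SG S''G _; exact: subsetUl.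
- by apply: subalg_generated_sub SG' S''G _; exact: subsetUr.
- move=> T ST S'T; apply: S''G.2 => a [Ga|G'a].
    by apply: ST; exact: SG.1.
  by apply: S'T; exact: SG'.1.
Qed.

(** Upper bounds for sequences are the reason for passing from I to Lambda: they give a whole
    sequence of cylinder sets a common base space. *)
Lemma count_gen_bigcup (T : nat -> subalgClosed A) : (forall n, count_gen (T n)) ->
  exists2 T', count_gen T' & forall n, {subset T n <= T'}.
Proof.
move=> Tc; have [G GP] : {G : nat -> set A &
    forall n, countable (G n) /\ subalg_generated (T n) (G n)}.
  apply: (@choice _ _ (fun n G => countable G /\ subalg_generated (T n) G)) => n.
  by have [G Gc TG] := Tc n; exists G.
have [T' T'G] := subalg_generated_exists (\bigcup_n G n); exists T'.
  by exists (\bigcup_n G n) => //; apply: bigcup_countable => // n _; have [] := GP n.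
move=> n; have [_ TG] := GP n.
by apply: subalg_generated_sub TG T'G _ => a Ga; exists n.
Qed.

Lemma fin_gen1 a : exists S, [/\ fin_gen S, a \in S &
  forall T, a \in T -> {subset S <= T}].
Proof.
have [S SG] := subalg_generated_exists [set a]; exists S; split.
- by exists [set a] => //; exact: finite_set1.
- exact: SG.1.
- by move=> T aT; apply: SG.2 => _ ->.
Qed.

Lemma char_eval_restr_sub S T (ST : {subset S <= T}) (s : subalg S)
  (x : char_space (subalg T)) :
  char_eval s (restr_sub ST x) = char_eval (subalg_incl ST s) x.
Proof. by []. Qed.

Lemma restr_sub_restr S T (ST : {subset S <= T}) (x : char_space A) :
  restr_sub ST (restr T x) = restr S x.
Proof. by apply: char_spaceP => s; exact: erefl. Qed.

Lemma restr_continuous S : continuous (@restr R A S).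
Proof. by apply: continuous_to_char => s; exact: char_eval_continuous. Qed.

Lemma restr_sub_continuous S T (ST : {subset S <= T}) :
  continuous (restr_sub ST).
Proof. by apply: continuous_to_char => s; exact: char_eval_continuous. Qed.

End GeneratedSubalgebras.

(** * Countably generated subalgebras *)

Section CountablyGenerated.
Context (R : realType) (A : charAlgType R) (T : subalgClosed A).
Context (Tc : count_gen T).
Let X := char_space (subalg T).

(** A triple lists a generator, a rational centre and a rational radius. Lists of triples form a
    countable type, so the boxes can serve as a countable base. *)
Definition rational_box (e : nat -> subalg T) (s : seq (nat * rat * rat)) :
    set X :=
  [set x | forall p, p \in s ->
    `|char_eval (e p.1.1) x - ratr p.1.2| < ratr p.2].

(** The boxes around [x] generate a filter. The elements whose evaluation converges along it include
    the generators and are closed under the algebra operations, hence exhaust the subalgebra, and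
    the filter converges to [x]. *)
Lemma rational_box_base (e : nat -> subalg T) (U : set X) x :
  subalg_generated T (range (val \o e)) -> open U -> U x ->
  exists s, rational_box e s x /\ rational_box e s `<=` U.
Proof.
move=> Te Uo Ux.
pose F := filter_from [set s | rational_box e s x] (rational_box e).
have FF : Filter F.
  apply: filter_from_filter; first by exists [::].
  move=> s t sx tx; exists (s ++ t) => [p|y yst].
    by rewrite mem_cat => /orP[/sx|/tx].
  by split=> p ps; apply: yst; rewrite mem_cat ps ?orbT.
suff : F --> x by move=> /(_ U) [|s ? ?]; [exact: open_nbhs_nbhs|exists s].
apply: char_cvg; apply: (subalg_ind Te).
- move=> a [n _ en]; have {en} -> : a = e n by exact: val_inj.
  move=> W /nbhs_ballP[d /= d0 dW].
  have [r] : exists r : rat, ratr r \in `]0, (d / 2)[.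
    by apply: rat_in_itvoo; rewrite divr_gt0.
  rewrite in_itv /= => /andP[r0 rd].
  have [q] : exists q : rat, ratr q \in
      `](char_eval (e n) x - ratr r), (char_eval (e n) x + ratr r)[.
    by apply: rat_in_itvoo; lra.
  rewrite in_itv /= => /andP[q1 q2].
  have xq : `|char_eval (e n) x - ratr q| < ratr r by rewrite ltr_norml; lra.
  exists [:: (n, q, r)] => [p|y /(_ (n, q, r))]; first by rewrite inE => /eqP ->.
  rewrite inE eqxx => /(_ isT) /= yq; apply: dW; rewrite /ball /=.
  by move: xq yq; rewrite !ltr_norml; lra.
- have -> : char_eval (1 : subalg T) = cst 1.
    by apply/funext => y; rewrite char_eval1.
  exact: cvg_cst.
- move=> c a b ha hb; rewrite char_evalD char_evalZ.
  have -> : char_eval (c *: a + b) = fun y => c * char_eval a y + char_eval b y.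
    by apply/funext => y; rewrite char_evalD char_evalZ.
  exact: (cvgD (cvgMl_tmp ha) hb).
- move=> a b ha hb; rewrite char_evalM.
  have -> : char_eval (a * b) = char_eval a \* char_eval b.
    by apply/funext => y; rewrite char_evalM.
  exact: (cvgM ha hb).
Qed.

Lemma measurable_to_char d (Y : measurableType d) (f : Y -> X) :
  (forall a, measurable_fun setT (char_eval a \o f)) ->
  measurable_fun setT (f : Y -> borel_space X).
Proof.
move=> fa; have [e Te] := count_gen_enum Tc.
apply: (measurability _
  (erefl : (measurable : set (set (borel_space X))) = <<s @open X >>)).
move=> _ [U Uo <-]; rewrite setTI.
(* The second factor does not depend on the point: it is everything if the box lies in [U] and empty
   otherwise, so the union can run over all lists. *)
have -> : U = \bigcup_(s in [set: seq (nat * rat * rat)])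
    (rational_box e s `&` [set x | rational_box e s `<=` U]).
  apply/seteqP; split=> [x Ux|x [s _ [sx sU]]]; last exact: sU.
  by have [s [sx sU]] := rational_box_base Te Uo Ux; exists s.
rewrite preimage_bigcup; apply: countable_bigcupT_measurable => // s.
have [sU|nsU] := pselect (rational_box e s `<=` U); last first.
  rewrite [X in measurable X](_ : _ = set0) //.
  by apply/seteqP; split=> // y [].
rewrite [X in measurable X](_ : _ = f @^-1` rational_box e s); last first.
  by apply/seteqP; split=> // y [].
elim: s {sU} => [|p s IH].
  by rewrite [X in measurable X](_ : _ = setT) //; apply/seteqP; split.
rewrite [X in measurable X](_ : _ = (char_eval (e p.1.1) \o f) @^-1`
    `](ratr p.1.2 - ratr p.2), (ratr p.1.2 + ratr p.2)[%classic `&`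
    f @^-1` rational_box e s).
  apply: measurableI => //; rewrite -[X in measurable X]setTI.
  by apply: (fa (e p.1.1)).
apply/seteqP; split=> [y ys|y [y1 y2] q].
  split; last by move=> q qs; apply: ys; rewrite inE qs orbT.
  by have := ys p (mem_head _ _); rewrite /= in_itv /= ltr_norml; lra.
rewrite inE => /orP[/eqP -> |]; last exact: y2.
by move: y1; rewrite /= in_itv /= ltr_norml; lra.
Qed.

(** This is [measurable_to_char] for the identity map. *)
Lemma borel_char_sub (G : set (set X)) :
  (forall a, measurable_fun [set: g_sigma_algebraType G] (char_eval a)) ->
  (measurable : set (set (borel_space X))) `<=` <<s G >>.
Proof.
move=> Ga M mM; have := @measurable_to_char _ (g_sigma_algebraType G) id Ga.
by move=> /(_ measurableT M mM); rewrite setTI preimage_id.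
Qed.

Lemma borel_char_unique (G : set (set X))
    (m1 m2 : {measure set (borel_space X) -> \bar R}) :
  setI_closed G -> G setT -> G `<=` (measurable : set (set (borel_space X))) ->
  (forall a, measurable_fun [set: g_sigma_algebraType G] (char_eval a)) ->
  (forall M, G M -> m1 M = m2 M) -> (m1 setT < +oo)%E ->
  forall M : set (borel_space X), measurable M -> m1 M = m2 M.
Proof.
move=> GI GT Gm Ga m12 m1fin.
apply: (@measure_unique _ _ (borel_space X) G (fun=> setT)) => //.
  apply/seteqP; split; first exact: borel_char_sub.
  apply: smallest_sub => //; exact: sigma_algebra_measurable.
by apply/seteqP; split=> // x _; exists 0%N.
Qed.

End CountablyGenerated.

Lemma radon_eq (R : realType) (X : ptopologicalType)
    (m1 m2 : {measure set (borel_space X) -> \bar R}) : hausdorff_space X ->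
  (forall M : set (borel_space X), measurable M -> m1 M = m2 M) ->
  radon m1 -> radon m2.
Proof.
move=> hX m12 [lf reg]; split=> [x|M mM].
  have [U [Uo Ux mU]] := lf x; exists U; split=> //.
  by rewrite -m12 //; exact: borel_open.
rewrite -m12 // reg //; congr ereal_sup; apply/seteqP.
split=> _ [C [Cc CM] <-]; exists C => //; rewrite m12 //;
  by apply: borel_closed; exact: compact_closed.
Qed.

Lemma borel_gt (R : realType) (X : ptopologicalType) (f : X -> R) (c : R) :
  continuous f -> measurable ([set x | c < f x] : set (borel_space X)).
Proof.
move=> fc; apply: borel_open; apply: (@open_comp _ _ f [set r | c < r]).
  by move=> x _; exact: fc.
exact: open_gt.
Qed.

Lemma continuous_normr (R : realType) (X : topologicalType) (f : X -> R) :
  continuous f -> continuous (fun x => `|f x|).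
Proof. by move=> fc x; apply: cvg_norm; exact: fc. Qed.

Lemma tight_level (R : realType) (X : ptopologicalType)
    (mu : {measure set (borel_space X) -> \bar R}) (h : X -> R) (e : R) :
  (mu setT < +oo)%E -> continuous h -> 0 < e ->
  exists r : R, (mu [set x | (r < `|h x|)%R] <= e%:E)%E.
Proof.
move=> mufin hc e0; pose F (n : nat) := [set x : borel_space X | n%:R < `|h x|].
have mF n : measurable (F n).
  exact: borel_gt (continuous_normr hc).
have F0 : \bigcap_n F n = set0.
  apply/seteqP; split=> // x Fx.
  have := Fx (Num.truncn `|h x|).+1 I; rewrite /F /= ltNge.
  by rewrite ltW // truncnS_gt.
have cv : (mu \o F) x @[x --> \oo] --> mu (\bigcap_n F n).
  apply: nonincreasing_cvg_mu => //.
  - apply: le_lt_trans mufin; apply: le_measure => //; rewrite inE //.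
  - by rewrite F0.
  - move=> n m nm; apply/subsetPset => x; apply: le_lt_trans.
    by rewrite ler_nat.
rewrite F0 measure0 in cv.
apply: contrapT => nr; have : (e%:E <= 0)%E; last by rewrite lee_fin leNgt e0.
rewrite -(cvg_lim _ cv) //; apply: lime_ge; first by apply/cvg_ex; eexists; exact: cv.
apply: nearW => n; rewrite leNgt; apply/negP => h_lt; apply: nr.
by exists n%:R; exact: ltW.
Qed.

(** * Tightness and regularity over countably generated subalgebras *)

Section CountablyGeneratedRadon.
Context (R : realType) (A : charAlgType R) (T : subalgClosed A).
Context (Tc : count_gen T).
Let X := char_space (subalg T).
Implicit Types (mu nu : {measure set (borel_space X) -> \bar R}).

Lemma bcont_integrable mu f : (mu setT < +oo)%E -> bcont f ->
  mu.-integrable setT (EFin \o f).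
Proof.
by move=> mufin [fc [c fb]]; exact: bounded_continuous_integrable fb.
Qed.

(** Cut off the n-th generator at a level exceeded only with mass [e / 2 ^ n.+1]. Bounds on the
    generators bound every element, so what remains lies in a compact box. *)
Lemma count_gen_tight mu (e : R) : (mu setT < +oo)%E -> 0 < e ->
  exists2 C : set X, compact C & (mu (~` C) <= e%:E)%E.
Proof.
move=> mufin e0; have [u Te] := count_gen_enum Tc.
have en0 n : 0 < e / (2 ^ n.+1)%:R by rewrite divr_gt0 // ltr0n expn_gt0.
have [r rP] := choice (fun n =>
  tight_level mufin (@char_eval_continuous R _ (u n)) (en0 n)).
pose C0 := [set x : X | forall n, `|char_eval (u n) x| <= r n].
have : forall a, exists b, forall x, C0 x -> `|char_eval a x| <= b.
  apply: (subalg_ind Te).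
  - by move=> a [n _ /val_inj <-]; exists (r n) => x; exact.
  - by exists 1 => x _; rewrite char_eval1 normr1.
  - move=> c a b [ra Ha] [rb Hb]; exists (`|c| * ra + rb) => x Cx.
    rewrite char_evalD char_evalZ; apply: le_trans (ler_normD _ _) _.
    by rewrite normrM lerD ?Hb // ler_wpM2l ?Ha.
  - move=> a b [ra Ha] [rb Hb]; exists (ra * rb) => x Cx.
    by rewrite char_evalM normrM ler_pM ?Ha ?Hb.
move=> /choice[b bP].
pose C := [set x : X | forall a, `|char_eval a x| <= b a].
exists C; first exact: compact_char_box.
have Ccl : closed C.
  by apply: compact_closed; [exact: char_space_hausdorff|exact: compact_char_box].
have mn n : measurable ([set x | r n < `|char_eval (u n) x|] : set (borel_space X)).
  exact: borel_gt (continuous_normr (@char_eval_continuous R _ (u n))).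
apply: le_trans (measure_sigma_subadditive mu mn _ _) _.
- by apply: borel_open; rewrite openC.
- move=> x nC; apply: contrapT => nx; apply: nC => a; apply: bP => n.
  by rewrite leNgt; apply/negP => nr; apply: nx; exists n.
apply: (@le_trans _ _ (\sum_(n <oo) (e / (2 ^ n.+1)%:R)%:E)%E).
  by apply: lee_nneseries => n _ //; exact: rP.
exact: (epsilon_trick0 xpredT (ltW e0)).
Qed.

(** A generating pi-system (intersections come from minima) on which a finite measure is determined
    by its integrals of bounded continuous functions. *)
Definition cozero_sets : set (set X) :=
  [set [set x | 0 < h x] | h in @bcont R (subalg T)].

Lemma cozero_sets_evaluation a :
  measurable_fun [set: g_sigma_algebraType cozero_sets] (char_eval a).
Proof.
apply: (measurability _ (RGenOInfty.measurableE R)).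
move=> _ [_ [c ->] <-]; rewrite setTI; apply: sub_sigma_algebra.
exists (truncated 1 (a - c *: 1)); first exact: bcont_truncated.
by apply/seteqP; split=> x /=; rewrite truncatedE in_itv /= andbT lt_max lt_min;
  rewrite -scaleNr char_evalD char_evalC subr_gt0 ltr01 /= oppr_gt0 ltr10.
Qed.

(** The function [clamp (n%:R *: h)] lies between the indicators of [1 < n%:R * h] and of [0 < h],
    and the former sets increase to the latter. *)
Lemma bcont_integral_le mu nu h : (mu setT < +oo)%E -> (nu setT < +oo)%E ->
  (forall f, bcont f -> (\int[mu]_x (f x)%:E = \int[nu]_x (f x)%:E)%E) ->
  bcont h -> (mu [set x | (0 < h x)%R] <= nu [set x | (0 < h x)%R])%E.
Proof.
move=> mufin nufin mn hb; have [hc _] := hb.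
pose U := [set x : borel_space X | 0 < h x].
pose F (n : nat) := [set x : borel_space X | 1 < n%:R * h x].
have mF n : measurable (F n).
  by have [nhc _] := bcontZ n%:R hb; exact: borel_gt nhc.
have mU : measurable U by exact: borel_gt.
have FU : \bigcup_n F n = U.
  apply/seteqP; split=> [x [n _]|x Ux].
    rewrite /F /U /= => h1; rewrite ltNge; apply/negP => h0.
    by move: h1; rewrite ltNge (le_trans (mulr_ge0_le0 _ h0)).
  exists (Num.truncn (h x)^-1).+1 => //; rewrite /F /=.
  by rewrite -ltr_pdivrMr // mul1r truncnS_gt.
have cv : (mu \o F) x @[x --> \oo] --> mu (\bigcup_n F n).
  apply: nondecreasing_cvg_mu => //; first by rewrite FU.
  move=> n m nm; apply/subsetPset => x; rewrite /F /= => h1.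
  apply: (lt_le_trans h1); apply: ler_wpM2r; last by rewrite ler_nat.
  rewrite leNgt; apply/negP => h0.
  by move: h1; rewrite ltNge (le_trans (mulr_ge0_le0 _ (ltW h0))).
rewrite -[X in (mu X <= _)%E]FU -(cvg_lim _ cv) //; apply: lime_le.
  by apply/cvg_ex; eexists; exact: cv.
apply: nearW => n /=.
pose g := clamp (n%:R *: h).
have gb : bcont g.
  by apply: (lattice_clamp (@bcont_lattice R _)); exact: bcontZ.
have [gc _] := gb.
have mg : measurable_fun [set: borel_space X] g by exact: measurable_continuous.
apply: (@le_trans _ _ (\int[mu]_x (g x)%:E)%E).
  rewrite -(setIT (F n)) -(integral_indic mu measurableT (mF n)).
  apply: ge0_le_integral => //.
  - by apply/measurable_EFinP; exact: measurable_indic.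
  - exact/measurable_EFinP.
  - move=> x _; rewrite lee_fin indicE; have /andP[g0 _] := clamp_itv (n%:R *: h) x.
    have [fx|fx] := boolP (x \in _); last exact: g0.
    move: fx; rewrite inE /F /= => fx.
    by rewrite /g clampE (min_idPl (ltW fx)) le_max lexx orbT.
rewrite mn // -[X in (_ <= nu X)%E](setIT U) -(integral_indic nu measurableT mU).
apply: ge0_le_integral => //.
- by move=> x _; rewrite lee_fin; have /andP[] := clamp_itv (n%:R *: h) x.
- exact/measurable_EFinP.
- by apply/measurable_EFinP; exact: measurable_indic.
- move=> x _; rewrite lee_fin indicE; have /andP[_ g1] := clamp_itv (n%:R *: h) x.
  have [fx|fx] := boolP (x \in _); first exact: g1.
  move: fx; rewrite notin_setE /U /= => /negP; rewrite -leNgt => hx.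
  rewrite /g clampE ge_max lexx ge_min; apply/orP; right.
  by rewrite -[(n%:R *: h) x]/(n%:R * h x) mulr_ge0_le0.
Qed.

(** Integration against [mu] is a tight functional, so a Radon measure has the same integrals; the
    two agree on cozero sets and hence on all Borel sets. *)
Theorem count_gen_radon mu : mu setT = 1%E -> radon mu.
Proof.
move=> mu1; have mufin : (mu setT < +oo)%E by rewrite mu1 ltry.
pose l f := \int[mu]_x (f : X -> R) x.
have bL := @bcont_lattice R (subalg T).
have int f : bcont f -> mu.-integrable setT (EFin \o f).
  exact: bcont_integrable.
have lT : tight_functional (@bcont R (subalg T)) l.
  split.
  - by move=> f g /int fi /int gi; rewrite -(RintegralD measurableT fi gi).
  - by move=> c f /int fi; rewrite -(RintegralZl c measurableT fi).
  - by move=> f _ f0; apply: Rintegral_ge0.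
  - by rewrite /l Rintegral_cst // mu1 mul1r.
  - move=> e e0; have [C Cc Ce] := count_gen_tight mufin e0; exists C => //.
    move=> f fb f01 fC; rewrite -lee_fin /l /Rintegral fineK; last first.
      by apply: integrable_fin_num => //; exact: int.
    apply: le_trans Ce.
    have mC : measurable (~` C : set (borel_space X)).
      apply: borel_open; rewrite openC; apply: compact_closed => //.
      exact: char_space_hausdorff.
    rewrite -[X in (_ <= mu X)%E]setIT -(integral_indic mu measurableT mC).
    apply: ge0_le_integral => //.
    + by move=> x _; rewrite lee_fin; have /andP[] := f01 x.
    + by apply/measurable_EFinP; apply: measurable_continuous; case: fb.
    + by apply/measurable_EFinP; exact: measurable_indic.
    + move=> x _; rewrite lee_fin indicE; have [xC|xC] := boolP (x \in _).
        by have /andP[] := f01 x.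
      by rewrite fC //; move: xC; rewrite notin_setE /= => /contrapT.
have [nu [nur nu1 nuE _]] :=
  tight_functional_measure bL lT (@char_space_hausdorff R _).
have nufin : (nu setT < +oo)%E by rewrite nu1 ltry.
apply: radon_eq nur; first exact: char_space_hausdorff.
have eqI f : bcont f -> (\int[nu]_x (f x)%:E = \int[mu]_x (f x)%:E)%E.
  move=> fb; rewrite nuE // /l /Rintegral fineK //.
  by apply: integrable_fin_num => //; exact: int.
apply: (@borel_char_unique R A T Tc cozero_sets) => //.
- move=> _ _ [f fb <-] [g gb <-]; exists (f \min g); first exact: (lattice_min bL).
  by apply/seteqP; split=> x /=; rewrite lt_min => /andP.
- exists (cst 1); first exact: bcont_cst.
  by apply/seteqP; split=> // x _ /=; exact: ltr01.
- by move=> _ [f [fc _] <-]; exact: borel_gt.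
- exact: cozero_sets_evaluation.
- move=> _ [h hb <-]; apply/eqP; rewrite eq_le; apply/andP; split;
    by apply: bcont_integral_le => // f fb; rewrite eqI.
Qed.

End CountablyGeneratedRadon.

(** * Haviland's theorem *)

Lemma representing_mass (R : realType) (B : charAlgType R)
    (G : set (set (char_space B))) (l : {scalar B}) (K : set (char_space B))
    (nu : {measure set (g_sigma_algebraType G) -> \bar R}) :
  l 1 = 1 -> representing l K nu -> nu setT = 1%E.
Proof.
move=> l1 [_ _ /(_ 1)[_]]; rewrite l1.
under eq_integral do rewrite char_eval1.
by rewrite integral_cst // mul1e.
Qed.

Lemma supported_integral_ge0 d (Y : measurableType d) (R : realType)
    (mu : {measure set Y -> \bar R}) (F : set Y) (g : Y -> R) :
  measurable F -> mu (~` F) = 0%E -> mu.-integrable setT (EFin \o g) ->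
  (forall x, F x -> 0 <= g x) -> 0 <= \int[mu]_x g x.
Proof.
move=> mF F0 gi gF; rewrite /Rintegral (negligible_integral _ _ gi F0) //.
  by apply: fine_ge0; apply: integral_ge0 => x [_ /contrapT Fx]; rewrite lee_fin gF.
exact: measurableC.
Qed.

Lemma closure_ge0 (R : realType) (X : topologicalType) (F : set X) (g : X -> R) :
  continuous g -> (forall x, F x -> 0 <= g x) -> forall x, closure F x -> 0 <= g x.
Proof.
move=> gc gF; have cl : closed [set x | 0 <= g x].
  apply: (@preimage_closed _ _ g [set r | 0 <= r]); last exact: closed_ge.
  by move=> x _; exact: gc.
by move=> x Fx; apply: cl; apply: closureS Fx.
Qed.

Section Haviland.
Context (R : realType) (A : charAlgType R) (S : subalgClosed A).
Context (Sf : fin_gen S).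
Let X := char_space (subalg S).

(** A bound on the sum of squares bounds each generator, hence each element of [S], so a sublevel
    set lies in a compact box. *)
Lemma fin_gen_proper : exists a : subalg S,
  (forall x : X, 0 <= char_eval a x) /\ forall r : R,
  exists2 C : set X, compact C & forall x, ~ C x -> r < char_eval a x.
Proof.
have [G /finite_seqP[s ->] SG] := Sf.
have [a aP] : exists a : subalg S, forall x : X, 0 <= char_eval a x /\
    forall t : subalg S, val t \in s -> char_eval t x ^+ 2 <= char_eval a x.
  have : {subset s <= S} by move=> b bs; exact: SG.1.
  elim: s {SG} => [_|b s IH bsS]; first by exists 0 => x; rewrite char_eval0.
  have [|a aP] := IH; first by move=> c cs; apply: bsS; rewrite inE cs orbT.
  pose b' : subalg S := Sub b (bsS b (mem_head _ _)).
  exists (b' ^+ 2 + a) => x; have [a0 as2] := aP x.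
  have b0 := sqr_ge0 (char_eval b' x).
  rewrite char_evalD char_evalX; split=> [|t]; first exact: addr_ge0.
  rewrite inE => /orP[/eqP tb|/as2 ts]; last by rewrite ler_wpDl.
  have -> : t = b' by apply: val_inj; rewrite tb SubK.
  by rewrite lerDl.
exists a; split=> [x|r]; first by have [] := aP x.
pose C0 := [set x : X | char_eval a x <= r].
have : forall t : subalg S, exists b, forall x, C0 x -> `|char_eval t x| <= b.
  apply: (subalg_ind SG).
  - move=> t ts; exists (r + 1) => x xr; have [a0 /(_ t ts) tx] := aP x.
    rewrite /C0 /= in xr; rewrite ler_norml; apply/andP; split; nra.
  - by exists 1 => x _; rewrite char_eval1 normr1.
  - move=> c t t' [b tb] [b' tb']; exists (`|c| * b + b') => x Cx.
    rewrite char_evalD char_evalZ; apply: le_trans (ler_normD _ _) _.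
    by rewrite normrM lerD ?tb' // ler_wpM2l ?tb.
  - move=> t t' [b tb] [b' tb']; exists (b * b') => x Cx.
    by rewrite char_evalM normrM ler_pM ?tb ?tb'.
move=> /choice[b bP]; exists [set x | forall t, `|char_eval t x| <= b t].
  exact: compact_char_box.
by move=> x nC; rewrite ltNge; apply/negP => xr; apply: nC => t; exact: bP.
Qed.

(** Properness of the cone of majorants is exactly the positivity of [l] on [pos_cone K]. *)
Theorem haviland (l : {scalar subalg S}) (K : set X) :
  l 1 = 1 -> closed K -> (forall a, pos_cone K a -> 0 <= l a) ->
  exists mu : {measure set (borel_space X) -> \bar R}, radon_representing l K mu.
Proof.
move=> l1 Kcl lK.
pose P : set ((X -> R) * R) := [set p | exists a,
  (forall x, K x -> p.1 x <= char_eval a x) /\ l a <= p.2].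
have coneP : proper_cone P.
  split.
  - by exists 0; split=> [x _|]; rewrite ?char_eval0 ?raddf0.
  - move=> f g c d [a [fa ac]] [b [gb bd]]; exists (a + b); split=> [x Kx|] /=.
      by rewrite char_evalD lerD ?fa ?gb.
    by rewrite raddfD lerD.
  - move=> t f c t0 [a [fa ac]]; exists (t *: a); split=> [x Kx|] /=.
      by rewrite char_evalZ ler_wpM2l ?(ltW t0) ?fa.
    by rewrite linearZ /= ler_wpM2l ?(ltW t0).
  - by move=> c [a [fa ac]]; apply: le_trans ac; apply: lK => x /fa.
have [phi [phiD phiZ phiP]] := cone_functional coneP.
set D := [set f | _] in phiD phiZ phiP.
have Db f : bcont f -> D f.
  move=> [_ [c fc]]; split; exists c; exists (c *: 1); split=> [x _|] /=;
    rewrite ?char_evalC ?linearZ /= ?l1 ?mulr1 //.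
    exact: le_trans (ler_norm _) (fc x).
  by apply: le_trans (fc x); rewrite -normrN; exact: ler_norm.
apply: (@representing_of_dominated _ _ l K (@bcont R (subalg S)) phi) => //.
- exact: bcont_lattice.
- exact: bcont_truncated.
- by move=> f g /Db ? /Db; exact: phiD.
- by move=> c f /Db; exact: phiZ.
- by move=> f a /Db Df fa; apply: phiP => //; exists a.
- move=> e e0; have [a [a0 aP]] := fin_gen_proper.
  (* Off [C] the proper function exceeds [r], so [f <= a / r] everywhere and [phi f <= l a / r],
     which this [r] makes at most [e]. *)
  pose r := `|l a| / e + 1.
  have r0 : 0 < r by rewrite ltr_wpDl // divr_ge0 // ltW.
  have [C Cc aC] := aP r; exists C => // f fb f01 fC.
  apply: (@le_trans _ _ (r^-1 * l a)).
    rewrite -linearZ; apply: phiP; first exact: Db.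
    exists (r^-1 *: a); split=> //= x _; rewrite char_evalZ.
    have [Cx|/aC ax] := pselect (C x).
      by rewrite fC // mulr_ge0 // invr_ge0 ltW.
    rewrite mulrC ler_pdivlMr //; have /andP[_ fx1] := f01 x.
    by apply: le_trans (ltW ax); rewrite ger_pMl.
  rewrite mulrC ler_pdivrMr // mulrDr mulr1 mulrCA mulfV ?gt_eqF // mulr1.
  by have := ler_norm (l a); lra.
Qed.

End Haviland.

(** * Prokhorov's condition *)

Section CylinderFunctions.
Context (R : realType) (A : charAlgType R).
Implicit Types (S T : subalgClosed A) (f : char_space A -> R).

Lemma bcont_comp (B B' : charAlgType R) (p : char_space B -> char_space B')
  (g : char_space B' -> R) : continuous p -> bcont g -> bcont (g \o p).
Proof.
move=> pc [gc [c gb]]; split; last by exists c => x; exact: gb.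
by move=> x; apply: continuous_comp; [exact: pc|exact: gc].
Qed.

Definition cylinder_function f := exists S (g : char_space (subalg S) -> R),
  [/\ fin_gen S, bcont g & f = g \o @restr R A S].

Lemma cylinder_function_join f f' : cylinder_function f -> cylinder_function f' ->
  exists S (g g' : char_space (subalg S) -> R),
    [/\ fin_gen S, bcont g, bcont g', f = g \o @restr R A S &
        f' = g' \o @restr R A S].
Proof.
move=> [S [g [Sf gb ->]]] [S' [g' [S'f g'b ->]]].
have [S'' [S''f SS'' S'S'' _]] := fin_gen_join Sf S'f.
exists S'', (g \o restr_sub SS''), (g' \o restr_sub S'S''); split=> //.
- by apply: bcont_comp => //; exact: restr_sub_continuous.
- by apply: bcont_comp => //; exact: restr_sub_continuous.
- by apply/funext => x /=; rewrite restr_sub_restr.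
- by apply/funext => x /=; rewrite restr_sub_restr.
Qed.

Lemma cylinder_function_bcont f : cylinder_function f -> bcont f.
Proof.
by move=> [S [g [_ gb ->]]]; apply: bcont_comp => //; exact: restr_continuous.
Qed.

Lemma cylinder_truncated t a : cylinder_function (truncated t a).
Proof.
have [S [Sf aS _]] := fin_gen1 a.
exists S, (truncated t (Sub a aS : subalg S)); split=> //.
exact: bcont_truncated.
Qed.

Lemma cylinder_function_lattice : function_lattice cylinder_function.
Proof.
split.
- by move=> f /cylinder_function_bcont[].
- by move=> f /cylinder_function_bcont /(lattice_bounded (@bcont_lattice R A)).
- move=> c; have [S [Sf _ _]] := fin_gen1 (1 : A).
  by exists S, (cst c); split=> //; exact: bcont_cst.
- move=> f f' hf hf'.
  have [S [g [g' [Sf gb g'b -> ->]]]] := cylinder_function_join hf hf'.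
  by exists S, (g + g'); split=> //; exact: bcontD.
- move=> c f [S [g [Sf gb ->]]].
  by exists S, (c *: g); split=> //; exact: bcontZ.
- move=> f f' hf hf'.
  have [S [g [g' [Sf gb g'b -> ->]]]] := cylinder_function_join hf hf'.
  by exists S, (g \max g'); split=> //; exact: bcont_max.
- move=> U x Uo Ux; have [a [ax aU]] := char_separates Uo Ux.
  exists (truncated 1 a); split=> [||y /aU ay]; first exact: cylinder_truncated.
    by rewrite truncatedE !lt_max lt_min ltr01 ax orbT.
  by rewrite truncatedE ge_max ge_min ay orbT andbT lerNl oppr0 ler01.
Qed.

Context (L : {scalar A}) (K : set (char_space A)) (mu : measure_family A).
Context (L1 : L 1 = 1) (Kcl : closed K) (muP : local_solutions L K mu).

Lemma local_solutions_mass S : fin_gen S -> mu S setT = 1%E.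
Proof.
move=> Sf; have [_ rep] := muP Sf.
by apply: representing_mass rep; rewrite /restr_lin /= rmorph1.
Qed.

(** Here [g] is integrable rather than bounded, in order to admit evaluations. Requiring it for all
    [S] above some [S0] lets majorants with different [S0] be added over the join. *)
Definition eventual_majorant : set ((char_space A -> R) * R) :=
  [set p | exists S0, fin_gen S0 /\ forall S, fin_gen S -> {subset S0 <= S} ->
    exists g : char_space (subalg S) -> R,
      [/\ continuous g, (mu S).-integrable setT (EFin \o g),
          forall x, K x -> p.1 x <= g (restr S x) & \int[mu S]_y g y <= p.2]].

(** Properness uses the support of [mu S]: a continuous [g] that is nonnegative on the image of [K]
    is so on its closure. *)
Lemma eventual_majorant_cone : proper_cone eventual_majorant.
Proof.
split.
- have [S0 [S0f _ _]] := fin_gen1 (1 : A); exists S0; split=> // S Sf _.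
  have [gc gb] := @bcont_cst R (subalg S) 0; exists (cst 0); split=> //.
    by apply: bcont_integrable => //; rewrite local_solutions_mass // ltry.
  by rewrite Rintegral_cst // mul0r.
- move=> f f' c c' [S0 [S0f fP]] [S0' [S0'f f'P]].
  have [S1 [S1f S01 S0'1 _]] := fin_gen_join S0f S0'f; exists S1; split=> // S Sf S1S.
  have [g [gc gi fg gl]] := fP S Sf (fun _ h => S1S _ (S01 _ h)).
  have [g' [g'c g'i fg' g'l]] := f'P S Sf (fun _ h => S1S _ (S0'1 _ h)).
  exists (g + g'); split.
  + by move=> x; exact: (cvgD (gc x) (g'c x)).
  + exact: (integrableD measurableT gi g'i).
  + by move=> x Kx; apply: lerD; [exact: fg|exact: fg'].
  + by rewrite (RintegralD measurableT gi g'i) lerD.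
- move=> t f c t0 [S0 [S0f fP]]; exists S0; split=> // S Sf S0S.
  have [g [gc gi fg gl]] := fP S Sf S0S; exists (t *: g); split.
  + by move=> x; exact: (cvgMl_tmp (a := t) (gc x)).
  + exact: (integrableZl measurableT t gi).
  + by move=> x Kx; apply: ler_wpM2l; [exact: ltW|exact: fg].
  + by rewrite (RintegralZl t measurableT gi) ler_wpM2l // ltW.
- move=> c [S0 [S0f fP]]; have [g [gc gi fg gl]] := fP S0 S0f (fun _ h => h).
  apply: le_trans gl; have [_ [mF F0 _]] := muP S0f.
  apply: (supported_integral_ge0 mF F0 gi); apply: closure_ge0 gc _.
  by move=> _ [x Kx <-]; exact: fg.
Qed.

Theorem prokhorov_representing : prokhorov mu ->
  exists nu : {measure set (borel_space (char_space A)) -> \bar R},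
    radon_representing L K nu.
Proof.
move=> muC; have [phi [phiD phiZ phiP]] := cone_functional eventual_majorant_cone.
set D := [set f | _] in phiD phiZ phiP.
have Db f : cylinder_function f -> D f.
  move=> /cylinder_function_bcont[_ [c fc]].
  have [S0 [S0f _ _]] := fin_gen1 (1 : A).
  split; exists c; exists S0; split=> // S Sf _;
    have [gc gb] := @bcont_cst R (subalg S) c; exists (cst c); split=> //.
  - by apply: bcont_integrable => //; rewrite local_solutions_mass // ltry.
  - by move=> x _; exact: le_trans (ler_norm _) (fc x).
  - by rewrite Rintegral_cst // local_solutions_mass // mulr1.
  - by apply: bcont_integrable => //; rewrite local_solutions_mass // ltry.
  - by move=> x _; apply: le_trans (fc x); rewrite -normrN; exact: ler_norm.
  - by rewrite Rintegral_cst // local_solutions_mass // mulr1.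
apply: (@representing_of_dominated _ _ L K cylinder_function phi) => //.
- exact: cylinder_function_lattice.
- exact: cylinder_truncated.
- by move=> f g /Db ? /Db; exact: phiD.
- by move=> c f /Db; exact: phiZ.
- move=> f a /Db Df fa; apply: phiP => //.
  have [S0 [S0f aS0 _]] := fin_gen1 a; exists S0; split=> // S Sf S0S.
  (* As soon as [S] contains [a], evaluation at [a] is an admissible [g] with integral [L a]. *)
  pose a' : subalg S := Sub a (S0S a aS0); exists (char_eval a').
  have [_ [_ _ rep]] := muP Sf; have [ai La] := rep a'; split=> //.
  + exact: char_eval_continuous.
  + by rewrite /Rintegral -La /= /restr_lin /= lexx.
- move=> e e0; have [C Cc CP] := muC e e0; exists C => // f fcyl f01 fC.
  apply: phiP; first exact: Db.
  have [S0 [g0 [S0f g0b fg0]]] := fcyl; exists S0; split=> // S Sf S0S.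
  (* The bounds on [f] control [g0] only on the image of X(A). Clamping enforces them everywhere
     without changing [f]; the integral is then at most the mass outside the image of [C]. *)
  pose g := clamp (g0 \o restr_sub S0S).
  have gb : bcont g.
    apply: (lattice_clamp (@bcont_lattice R _)); apply: bcont_comp => //.
    exact: restr_sub_continuous.
  have mufin : (mu S setT < +oo)%E by rewrite local_solutions_mass // ltry.
  have gE x : g (restr S x) = f x.
    rewrite /g clampE /= restr_sub_restr -[g0 _]/((g0 \o @restr R A S0) x) -fg0.
    by have /andP[f0 f1] := f01 x; rewrite (min_idPr f1); apply/max_idPr.
  exists g; split.
  + by case: gb.
  + exact: bcont_integrable.
  + by move=> x _; rewrite gE.
  + rewrite -lee_fin /Rintegral fineK; last first.
      by apply: integrable_fin_num => //; exact: bcont_integrable.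
    have Ccl : closed (@restr R A S @` C).
      apply: compact_closed; first exact: char_space_hausdorff.
      apply: continuous_compact => //; apply: continuous_subspaceT.
      exact: restr_continuous.
    have mC := borel_closed Ccl; have mnC := measurableC mC.
    apply: (@le_trans _ _ (mu S (~` (@restr R A S @` C)))).
      rewrite -[X in (_ <= mu S X)%E]setIT -(integral_indic (mu S) measurableT mnC).
      apply: ge0_le_integral => //.
      * by move=> y _; rewrite lee_fin; have /andP[] := clamp_itv (g0 \o restr_sub S0S) y.
      * by apply/measurable_EFinP; apply: measurable_continuous; case: gb.
      * by apply/measurable_EFinP; exact: measurable_indic.
      * move=> y _; rewrite lee_fin indicE; have [yC|yC] := boolP (y \in _).
          by have /andP[] := clamp_itv (g0 \o restr_sub S0S) y.
        move: yC; rewrite notin_setE /= => /contrapT[x Cx <-].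
        by rewrite gE fC.
    have := CP S Sf; set F := (_ @` C) in mC mnC *.
    have FnF : (mu S F + mu S (~` F) = 1)%E.
      by rewrite -measureU ?setICr // setUv; exact: local_solutions_mass.
    have fin M : measurable M -> mu S M \is a fin_num.
      move=> mM; rewrite ge0_fin_numE // (le_lt_trans _ mufin) //.
      by apply: le_measure; rewrite ?inE.
    move: FnF; rewrite -(fineK (fin _ mC)) -(fineK (fin _ mnC)) -EFinD.
    by move=> [h]; rewrite !lee_fin /=; lra.
Qed.

End CylinderFunctions.

(** * The cylinder sigma-algebra *)

(* The library's instance takes the measurability of the map as an argument,
   which inference cannot supply. *)
Local Notation pushforward_measure :=
  measure_function_pushforward__canonical__measure_function_Measure.

Section Cylinders.
Context (R : realType) (A : charAlgType R).
Implicit Types (S T : subalgClosed A).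

Lemma restr_borel_measurable T :
  measurable_fun setT (@restr R A T : borel_space (char_space A) ->
    borel_space (char_space (subalg T))).
Proof.
apply: (measurability _ (erefl : (measurable : set (set (borel_space
  (char_space (subalg T))))) = <<s @open (char_space (subalg T)) >>)).
move=> _ [U Uo <-]; rewrite setTI; apply: borel_open.
by apply: open_comp => // x _; exact: restr_continuous.
Qed.

Lemma restr_sub_borel_measurable S T (ST : {subset S <= T}) :
  measurable_fun setT (restr_sub ST : borel_space (char_space (subalg T)) ->
    borel_space (char_space (subalg S))).
Proof.
apply: (measurability _ (erefl : (measurable : set (set (borel_space
  (char_space (subalg S))))) = <<s @open (char_space (subalg S)) >>)).
move=> _ [U Uo <-]; rewrite setTI; apply: borel_open.
by apply: open_comp => // x _; exact: restr_sub_continuous.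
Qed.

Lemma cylinder_char_eval a :
  measurable_fun [set: cylinder_space A] (char_eval a).
Proof.
have [S [Sf aS _]] := fin_gen1 a.
move=> _ M mM; rewrite setTI; apply: sub_sigma_algebra; exists S; split=> //.
exists (char_eval (Sub a aS : subalg S) @^-1` M) => //.
rewrite -[X in measurable X]setTI; apply: measurable_continuous => //.
exact: char_eval_continuous.
Qed.

Lemma restr_cylinder_measurable T : count_gen T ->
  measurable_fun setT (@restr R A T : cylinder_space A ->
    borel_space (char_space (subalg T))).
Proof. by move=> Tc; apply: measurable_to_char => // a; exact: cylinder_char_eval. Qed.

Section Pushforward.
Context (G : set (set (char_space A))) (L : {scalar A}) (K : set (char_space A)).
Context (m : {measure set (g_sigma_algebraType G) -> \bar R}).
Context (L1 : L 1 = 1) (mrep : representing L K m).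

Context (mrestr : forall S, count_gen S ->
  measurable_fun setT (@restr R A S : g_sigma_algebraType G ->
    borel_space (char_space (subalg S)))).

(** The generating family [G] is left open so that both the cylinder and the Borel sigma-algebra of
    X(A) are covered. Outside Lambda the family is filled with the zero measure. *)
Lemma push_family : exists mu : measure_family A, forall S, count_gen S ->
  (forall M : set (char_space (subalg S)), mu S M = m (@restr R A S @^-1` M)) /\
  forall F : set (char_space (subalg S)), closed F ->
    m (~` (@restr R A S @^-1` F)) = 0%E -> representing (restr_lin L S) F (mu S).
Proof.
suff one S : exists mS : {measure set (borel_space (char_space (subalg S))) -> \bar R},
    count_gen S ->
    (forall M : set (char_space (subalg S)), mS M = m (@restr R A S @^-1` M)) /\
    forall F : set (char_space (subalg S)), closed F ->
      m (~` (@restr R A S @^-1` F)) = 0%E -> representing (restr_lin L S) F mS.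
  by exists (fun S => projT1 (cid (one S))) => S; exact: (projT2 (cid (one S))).
have [Sc|nSc] := pselect (count_gen S); last by exists mzero.
have mS := mrestr Sc.
exists (pushforward_measure m mS) => _.
split=> // F Fcl F0; split=> //; first exact: borel_closed.
move=> s; have [_ _ /(_ (val s))[si sL]] := mrep.
have ms : measurable_fun [set: borel_space (char_space (subalg S))]
    (fun x => (char_eval s x)%:E).
  by apply/measurable_EFinP; apply: measurable_continuous; exact: char_eval_continuous.
split; first exact: (integrable_pushforward mS ms si).
rewrite /= /restr_lin /= sL.
exact/esym/(integral_pushforward mS ms si measurableT).
Qed.

End Pushforward.

Lemma push_family_properties (G : set (set (char_space A))) (L : {scalar A})
    (K K0 : set (char_space A)) (m : {measure set (g_sigma_algebraType G) -> \bar R}) :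
  L 1 = 1 -> representing L K0 m ->
  (forall S, count_gen S -> measurable_fun setT (@restr R A S : g_sigma_algebraType G ->
    borel_space (char_space (subalg S)))) ->
  (forall S, fin_gen S ->
    m (~` (@restr R A S @^-1` closure (@restr R A S @` K))) = 0%E) ->
  exists mu : measure_family A, [/\ local_solutions L K mu,
    forall S, count_gen S -> radon (mu S) /\ mu S setT = 1%E &
    forall S, count_gen S ->
      forall M : set (char_space (subalg S)), mu S M = m (@restr R A S @^-1` M)].
Proof.
move=> L1 mrep mrestr mK; have [mu muP] := push_family mrep mrestr.
have mu1 S : count_gen S -> mu S setT = 1%E.
  by move=> /muP[-> _]; rewrite preimage_setT; exact: representing_mass mrep.
exists mu; split=> [S Sf|S Sc|S /muP[]//].
- have Sc := fin_gen_count_gen Sf; split.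
    by apply: count_gen_radon => //; exact: mu1.
  by have [_] := muP S Sc; apply; [exact: closed_closure|exact: mK].
- by split; [apply: count_gen_radon => //|]; exact: mu1.
Qed.

(** One family of pushforwards serves on I and on Lambda. It is thick because a set that misses the
    image of X(A) has empty preimage. *)
Theorem cylinder_solution_systems (L : {scalar A}) (K : set (char_space A))
    (m : {measure set (cylinder_space A) -> \bar R}) :
  L 1 = 1 -> cylinder_solution L K m ->
  exists mu : measure_family A,
    [/\ local_solutions L K mu, exact_system (@fin_gen R A) mu
      & exists2 muL : measure_family A, corresponding_system mu muL & thick muL].
Proof.
move=> L1 [mrep mK].
have [mu [muL muR muE]] :=
  push_family_properties L1 mrep restr_cylinder_measurable mK.
have push_exact S T (ST : {subset S <= T}) (M : set (char_space (subalg S))) :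
    count_gen S -> count_gen T -> restr_push ST (mu T) M = mu S M.
  move=> Sc Tc; rewrite /restr_push /pushforward !muE //; congr (m _).
  by apply/seteqP; split=> x; rewrite /preimage /= restr_sub_restr.
exists mu; split=> //.
  by move=> S T ST Sf Tf M _; apply: push_exact; exact: fin_gen_count_gen.
exists mu => [T Tc|T Tc M mM TM].
  have [Tr T1] := muR T Tc; split=> // S ST Sf M _.
  by apply: push_exact => //; exact: fin_gen_count_gen.
rewrite muE // (_ : _ @^-1` _ = set0) //; apply/seteqP; split=> // x Mx.
have : (range (@restr R A T) `&` M) (restr T x) by split=> //; exists x.
by rewrite TM.
Qed.

(** Inner regularity of [nu] on the whole space gives one compact [C] of mass above [1 - e], and [C]
    lies in the preimage of its image for every [S]. *)
Theorem radon_representing_prokhorov (L : {scalar A}) (K : set (char_space A))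
    (nu : {measure set (borel_space (char_space A)) -> \bar R}) :
  L 1 = 1 -> radon_representing L K nu ->
  exists mu : measure_family A, local_solutions L K mu /\ prokhorov mu.
Proof.
move=> L1 [[_ nureg] nurep]; have [mK nuK _] := nurep.
have nu1 : nu setT = 1%E by exact: representing_mass nurep.
have mpre S (F : set (char_space (subalg S))) : closed F ->
    measurable (@restr R A S @^-1` F : set (borel_space (char_space A))).
  move=> Fcl; apply: borel_closed; apply: preimage_closed => // x _.
  exact: restr_continuous.
have [S|mu [muL _ muE]] := push_family_properties (K := K) L1 nurep
  (fun S _ => @restr_borel_measurable S).
  move=> _; apply/eqP; rewrite eq_le measure_ge0 andbT -nuK; apply: le_measure.
  - by rewrite inE; apply: measurableC; apply: mpre; exact: closed_closure.
  - by rewrite inE; exact: measurableC.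
  - by move=> x nx Kx; apply: nx; apply: subset_closure; exists x.
exists mu; split=> // e e0.
have : ((1 - e)%:E < nu setT)%E by rewrite nu1 lte_fin ltrBlDr ltrDl.
rewrite nureg // => /ereal_sup_gt[_ [C [Cc _] <-] Ce]; exists C => // S Sf.
have Fcl : closed (@restr R A S @` C).
  apply: compact_closed; first exact: char_space_hausdorff.
  apply: continuous_compact => //; apply: continuous_subspaceT.
  exact: restr_continuous.
rewrite muE; last exact: fin_gen_count_gen.
apply: le_trans (ltW Ce) _; apply: le_measure.
- rewrite inE; apply: borel_closed; apply: compact_closed => //.
  exact: char_space_hausdorff.
- by rewrite inE; exact: mpre.
- by move=> x Cx; exists x.
Qed.

(** The complement of [K] is the countable union, over generators [a] of [Q], of the sets where [a]
    is negative. Each is null: some [S] in I contains [a], and [a] is nonnegative on the closure of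
    the image of [K] in X(S). *)
Theorem cylinder_solution_supported (L : {scalar A}) (K : set (char_space A))
    (Q : set A) (m : {measure set (cylinder_space A) -> \bar R}) :
  K = nonneg_set Q -> qm_count_gen Q ->
  cylinder_solution L K m -> representing L K m.
Proof.
move=> KQ [G Gc QG] [[_ _ mrep] mK].
have KE : K = \bigcap_(a in G) [set x | 0 <= char_eval a x].
  rewrite KQ QG; apply/seteqP; split=> [x Kx a Ga|x Kx a].
    by apply: Kx; exact: sub_gen_smallest.
  (* The elements nonnegative at [x] form a quadratic module, so they contain [Q] once they contain
     [G]. *)
  move=> /(_ (pos_cone [set x])); apply; last by [].
  split; first exact: quadratic_module_pos_cone.
  by move=> b Gb _ ->; exact: Kx.
pose N a : set (cylinder_space A) := [set x | char_eval a x < 0].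
have mN a : measurable (N a).
  have -> : N a = setT `&` char_eval a @^-1` `]-oo, 0[%classic.
    by rewrite setTI; apply/seteqP; split=> x; rewrite /N /preimage /= in_itv.
  exact: (@cylinder_char_eval a measurableT _ (measurable_itv _)).
have N0 a : G a -> m (N a) = 0%E.
  move=> Ga; have [S [Sf aS _]] := fin_gen1 a.
  have clm : measurable (~` (@restr R A S @^-1` closure (@restr R A S @` K))
      : set (cylinder_space A)).
    apply: measurableC; rewrite -[X in measurable X]setTI.
    apply: restr_cylinder_measurable => //; first exact: fin_gen_count_gen.
    by apply: borel_closed; exact: closed_closure.
  apply/eqP; rewrite eq_le measure_ge0 andbT -(mK S Sf).
  apply: le_measure; rewrite ?inE // => x ax clx; move: ax; rewrite /N /= ltNge.
  move=> /negP; apply; pose a' : subalg S := Sub a aS.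
  rewrite -[char_eval a x]/(char_eval a' (restr S x)).
  apply: closure_ge0 clx; first exact: char_eval_continuous.
  by move=> _ [y Ky <-]; move: Ky; rewrite KE => /(_ a Ga).
have nKE : ~` K = \bigcup_(a in G) N a.
  rewrite KE setC_bigcap; apply: eq_bigcupr => a _; apply/seteqP.
  by split=> x; rewrite /N /= ltNge => /negP.
have [f finj] := countable_injP _ Gc.
pose F n := \bigcup_(a in [set a | G a /\ f a = n]) N a.
have FN n : (exists2 a, G a & F n = N a) \/ F n = set0.
  have [[a [Ga fa]]|nG] := pselect (exists a, G a /\ f a = n); [left|right].
    exists a => //; apply/seteqP; split=> [x [b [Gb fb]]|x ax]; last by exists a.
    by have -> : b = a by apply: finj; rewrite ?inE // fa fb.
  by apply/seteqP; split=> // x [b h _]; apply: nG; exists b.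
have mF n : measurable (F n) by case: (FN n) => [[a _ ->]|->].
have nKF : ~` K = \bigcup_n F n.
  rewrite nKE; apply/seteqP; split=> [x [a Ga ax]|x [n _ [a [Ga _] ax]]].
    by exists (f a) => //; exists a.
  by exists a.
have mnK : measurable (~` K : set (cylinder_space A)).
  by rewrite nKF; exact: bigcupT_measurable.
split=> //; first by have := measurableC mnK; rewrite setCK.
apply/eqP; rewrite eq_le measure_ge0 andbT.
apply: le_trans (measure_sigma_subadditive m mF mnK _) _; first by rewrite nKF.
rewrite eseries0 // => n _ _; case: (FN n) => [[a Ga ->]|->]; last exact: measure0.
exact: N0.
Qed.

End Cylinders.

(** * Thick systems *)

Section ThickSystems.
Context (R : realType) (A : charAlgType R) (L : {scalar A}).
Context (K : set (char_space A)) (mu muL : measure_family A).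
Context (muP : local_solutions L K mu).
Context (muLP : corresponding_system mu muL) (muLt : thick muL).
Implicit Types (S T : subalgClosed A).

Lemma corresponding_mass_fin T : count_gen T -> (muL T setT < +oo)%E.
Proof. by move=> Tc; have [_ -> _] := muLP Tc; exact: ltry. Qed.

Lemma restr_sub_comp S T T' (ST : {subset S <= T}) (TT' : {subset T <= T'})
    (ST' : {subset S <= T'}) (x : char_space (subalg T')) :
  restr_sub ST (restr_sub TT' x) = restr_sub ST' x.
Proof.
apply: char_spaceP => s; rewrite !char_eval_restr_sub.
by congr char_eval; exact: val_inj.
Qed.

Lemma restr_sub_measurable_preimage S T (ST : {subset S <= T})
    (M : set (borel_space (char_space (subalg S)))) : measurable M ->
  measurable (restr_sub ST @^-1` M : set (borel_space (char_space (subalg T)))).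
Proof.
by move=> mM; rewrite -[X in measurable X]setTI; exact: restr_sub_borel_measurable.
Qed.

(** Both measures on X(T) restrict to [mu S] for every [S] in I below [T]. The cylinders over such
    [S] form a pi-system generating the Borel sets, as each element of [T] lies in one of them. *)
Lemma corresponding_exact T T' (TT' : {subset T <= T'})
    (M : set (borel_space (char_space (subalg T)))) :
  count_gen T -> count_gen T' -> measurable M ->
  muL T' (restr_sub TT' @^-1` M) = muL T M.
Proof.
move=> Tc T'c mM; have [_ _ muT] := muLP Tc; have [_ _ muT'] := muLP T'c.
pose G : set (set (char_space (subalg T))) := [set E | exists S (ST : {subset S <= T}),
  fin_gen S /\ exists2 N : set (borel_space (char_space (subalg S))),
    measurable N & E = restr_sub ST @^-1` N].
pose m1 := pushforward_measure
  (muL T') (@restr_sub_borel_measurable R A T T' TT').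
apply: (@borel_char_unique R A T Tc G m1 (muL T)) => //.
- move=> _ _ [S1 [S1T [S1f [N1 mN1 ->]]]] [S2 [S2T [S2f [N2 mN2 ->]]]].
  have [S [Sf S1S S2S /(_ T S1T S2T) ST]] := fin_gen_join S1f S2f.
  exists S, ST; split=> //.
  exists (restr_sub S1S @^-1` N1 `&` restr_sub S2S @^-1` N2).
    by apply: measurableI; exact: restr_sub_measurable_preimage.
  by apply/seteqP; split=> x; rewrite /setI /preimage /= !(restr_sub_comp _ _ S1T)
    !(restr_sub_comp _ _ S2T).
- have [S [Sf _ /(_ T (rpred1 T)) ST]] := fin_gen1 (1 : A).
  by exists S, ST; split=> //; exists setT.
- by move=> _ [S [ST [Sf [N mN ->]]]]; exact: restr_sub_measurable_preimage.
- move=> a; have [S [Sf aS /(_ T (valP a)) ST]] := fin_gen1 (val a).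
  pose a' : subalg S := Sub (val a) aS.
  have aE : char_eval a = char_eval a' \o restr_sub ST.
    apply/funext => x; rewrite [RHS]char_eval_restr_sub.
    by congr char_eval; exact: val_inj.
  move=> _ N mN; rewrite setTI; apply: sub_sigma_algebra; exists S, ST; split=> //.
  exists (char_eval a' @^-1` N); last by rewrite aE.
  rewrite -[X in measurable X]setTI; apply: measurable_continuous => //.
  exact: char_eval_continuous.
- move=> _ [S [ST [Sf [N mN ->]]]].
  have ST' : {subset S <= T'} by move=> a /ST /TT'.
  have <- : restr_push ST (muL T) N = muL T (restr_sub ST @^-1` N) by [].
  rewrite muT // -(muT' S ST' Sf N mN) /restr_push /m1 /= /pushforward.
  congr (muL T' _); apply/seteqP.
  by split=> x; rewrite /preimage /= (restr_sub_comp _ _ ST').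
- by rewrite /m1 /= /pushforward preimage_setT; exact: corresponding_mass_fin.
Qed.

Definition cylinder_base T (M : set (borel_space (char_space (subalg T))))
    (E : set (char_space A)) :=
  [/\ count_gen T, measurable M & E = @restr R A T @^-1` M].

Lemma cylinder_base_lift T T' (TT' : {subset T <= T'}) M E :
  @cylinder_base T M E -> count_gen T' ->
  cylinder_base (restr_sub TT' @^-1` M) E.
Proof.
move=> [Tc mM ->] T'c; split=> //; first exact: restr_sub_measurable_preimage.
by apply/seteqP; split=> x; rewrite /preimage /= restr_sub_restr.
Qed.

(** Sets with the same preimage differ only off the image of X(A), so thickness makes [M] minus [M']
    a null set. *)
Lemma thick_le T M M' E : @cylinder_base T M E -> @cylinder_base T M' E ->
  (muL T M <= muL T M')%E.
Proof.
move=> [Tc mM EM] [_ mM' EM'].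
have mD : measurable (M `\` M') by exact: measurableD.
have D0 : muL T (M `\` M') = 0%E.
  apply: muLt => //; apply/seteqP; split=> // _ [[x _ <-] [xM]]; apply.
  have : E x by rewrite EM.
  by rewrite EM'.
apply: (@le_trans _ _ (muL T (M' `|` (M `\` M')))).
  apply: le_measure; rewrite ?inE //; first exact: measurableU.
  move=> x Mx; have [?|?] := pselect (M' x); first by left.
  by right.
have : (muL T (M' `|` (M `\` M')) <= muL T M' + muL T (M `\` M'))%E by exact: measureU2.
by rewrite D0 adde0.
Qed.

Lemma thick_unique T M T' M' E : @cylinder_base T M E -> @cylinder_base T' M' E ->
  muL T M = muL T' M'.
Proof.
move=> EM EM'; have [Tc mM _] := EM; have [T'c mM' _] := EM'.
have [|T'' T''c sub] := @count_gen_bigcup _ _ (fun n => if n is 0%N then T else T').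
  by case.
have TT := sub 0%N; have T'T := sub 1%N; rewrite /= in TT T'T.
rewrite -(corresponding_exact TT Tc T''c mM) -(corresponding_exact T'T T'c T''c mM').
have h := cylinder_base_lift TT EM T''c; have h' := cylinder_base_lift T'T EM' T''c.
by apply/eqP; rewrite eq_le (thick_le h h') (thick_le h' h).
Qed.

(* The value 0 is junk off the cylinder sigma-algebra. *)
Definition thick_measure (E : set (cylinder_space A)) : \bar R :=
  xget 0%E [set v | exists T M, @cylinder_base T M E /\ v = muL T M].

Lemma thick_measureE T M E : @cylinder_base T M E -> thick_measure E = muL T M.
Proof.
move=> EM; rewrite /thick_measure; have [|T' [M' [EM' ->]]] := @xgetPex _ 0%E
    [set v | exists T M, @cylinder_base T M E /\ v = muL T M].
  by exists (muL T M), T, M.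
exact: thick_unique EM' EM.
Qed.

Lemma cylinder_base_seq (F : nat -> set (char_space A)) :
  (forall n, exists T M, @cylinder_base T M (F n)) ->
  exists T (M : nat -> set (borel_space (char_space (subalg T)))),
    count_gen T /\ forall n, cylinder_base (M n) (F n).
Proof.
move=> /choice[T TP].
have [|T' T'c TT'] := @count_gen_bigcup _ _ T; first by move=> n; have [M []] := TP n.
exists T'.
suff /choice[M MP] : forall n, exists M, @cylinder_base T' M (F n) by exists M.
by move=> n; have [M h] := TP n; exists (restr_sub (TT' n) @^-1` M);
  exact: cylinder_base_lift.
Qed.

Lemma cylinder_base_measurable (E : set (cylinder_space A)) :
  measurable E -> exists T M, @cylinder_base T M E.
Proof.
suff : <<s @cylinders R A >> `<=` [set E | exists T M, @cylinder_base T M E] by apply.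
apply: smallest_sub; last first.
  move=> _ [S [Sf [M mM ->]]]; exists S, M; split=> //; exact: fin_gen_count_gen.
split.
- have [S [Sf _ _]] := fin_gen1 (1 : A); exists S, set0.
  by split=> //; exact: fin_gen_count_gen.
- move=> _ [T [M [Tc mM ->]]]; exists T, (~` M); split=> //; first exact: measurableC.
  by rewrite setTD.
- move=> F /cylinder_base_seq[T [M [Tc MF]]]; exists T, (\bigcup_n M n); split=> //.
    by apply: bigcupT_measurable => n; have [] := MF n.
  rewrite preimage_bigcup; apply: eq_bigcupr => n _.
  by have [] := MF n.
Qed.

Lemma thick_measure0 : thick_measure set0 = 0%E.
Proof.
have [T [M h]] := cylinder_base_measurable measurable0.
have [Tc _ _] := h; by rewrite (@thick_measureE T set0) ?measure0.
Qed.

Lemma thick_measure_ge0 E : (0 <= thick_measure E)%E.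
Proof.
rewrite /thick_measure; case: xgetP => // v _ [T [M [_ ->]]]; exact: measure_ge0.
Qed.

(** Bases [M n] of disjoint sets may overlap off the image of X(A). Making them disjoint by [seqDU]
    leaves their preimages unchanged, and additivity of [muL T] applies. *)
Lemma thick_measure_sigma_additive : semi_sigma_additive thick_measure.
Proof.
move=> F mF tF mUF.
have [T [M [Tc MF]]] := cylinder_base_seq (fun n => cylinder_base_measurable (mF n)).
have mM n : measurable (M n) by have [] := MF n.
have mD n : measurable (seqDU M n).
  by apply: measurableD => //; apply: bigsetU_measurable.
have DF n : cylinder_base (seqDU M n) (F n).
  split=> //; apply/seteqP; split=> [x Fx|x [Mx _]]; last first.
    by have [_ _ ->] := MF n.
  split; first by move: Fx; have [_ _ ->] := MF n.
  rewrite -bigcup_mkord => -[k /= kn Mk]; have Fk : F k x by have [_ _ ->] := MF k.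
  have /trivIsetP/(_ k n I I) := tF; rewrite ltn_eqF // => /(_ isT)/seteqP[+ _].
  by move=> /(_ x); apply.
have UF : cylinder_base (\bigcup_n seqDU M n) (\bigcup_n F n).
  split=> //; first exact: bigcupT_measurable.
  rewrite preimage_bigcup; apply: eq_bigcupr => n _.
  by have [] := DF n.
rewrite (thick_measureE UF).
under eq_fun do under eq_bigr do rewrite (thick_measureE (DF _)).
apply: (@measure_semi_sigma_additive _ _ _ (muL T) (seqDU M)) => //.
exact: bigcupT_measurable.
Qed.

(** Every [a] lies in some [S] in I, and the pushforward of the glued measure to X(S) is [mu S];
    integrability and the value [L a] are transferred from there. *)
Theorem thick_cylinder_solution :
  exists m : {measure set (cylinder_space A) -> \bar R}, cylinder_solution L K m.
Proof.
pose m : {measure set (cylinder_space A) -> \bar R} :=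
  HB.pack thick_measure (isMeasure.Build _ (cylinder_space A) R thick_measure
    thick_measure0 thick_measure_ge0 thick_measure_sigma_additive).
have mS S (M : set (borel_space (char_space (subalg S)))) : fin_gen S ->
    measurable M -> m (@restr R A S @^-1` M) = mu S M.
  move=> Sf mM; have Sc := fin_gen_count_gen Sf.
  have [_ _ muS] := muLP Sc; rewrite -(muS S (fun _ h => h) Sf M mM).
  rewrite -[LHS]/(thick_measure _) (@thick_measureE S M) //.
  rewrite /restr_push /pushforward; congr (muL S _).
  have idE x : restr_sub (fun (a : A) (h : a \in S) => h) x = x.
    apply: char_spaceP => s; rewrite char_eval_restr_sub.
    by congr char_eval; exact: val_inj.
  by apply/seteqP; split=> x; rewrite /preimage /= idE.
exists m; split; last first.
  move=> S Sf; rewrite preimage_setC mS //; last first.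
    by apply: measurableC; apply: borel_closed; exact: closed_closure.
  by have [_ [_ -> _]] := muP Sf.
split=> //; first by rewrite setCT measure0.
move=> a; have [S [Sf aS _]] := fin_gen1 a; pose a' : subalg S := Sub a aS.
have [_ [_ _ /(_ a')[ai La]]] := muP Sf.
have mrS := restr_cylinder_measurable (fin_gen_count_gen Sf).
have ma : measurable_fun [set: borel_space (char_space (subalg S))] (char_eval a').
  by apply: measurable_continuous; exact: char_eval_continuous.
pose pm := pushforward_measure m mrS.
have pE (f : borel_space (char_space (subalg S)) -> \bar R) :
    (\int[pm]_x f x = \int[mu S]_x f x)%E.
  by apply: eq_measure_integral => M mM _; exact: mS.
have aE : char_eval a = char_eval a' \o @restr R A S by [].
have ai' : m.-integrable setT (fun x => (char_eval a x)%:E).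
  apply/integrableP; split; first by apply/measurable_EFinP; exact: cylinder_char_eval.
  have [_] := integrableP _ _ _ ai; rewrite -pE ge0_integral_pushforward //.
  by apply/measurableT_comp => //; exact/measurable_EFinP.
split=> //; rewrite -[L a]/(restr_lin L S a') La -pE integral_pushforward //.
exact/measurable_EFinP.
Qed.

End ThickSystems.

Theorem theorem3p14 (R : realType) (A : charAlgType R) (L : {scalar A})
    (K : set (char_space A)) :
  L 1 = 1 -> closed K -> (forall a, pos_cone K a -> 0 <= L a) ->
  [/\ (* (i) *)
      forall S : subalgClosed A, fin_gen S ->
        exists mu : {measure set (borel_space (char_space (subalg S))) -> \bar R},
          radon_representing (restr_lin L S) (closure (@restr R A S @` K)) mu,
      (* (ii) *)
      (exists mu : {measure set (cylinder_space A) -> \bar R},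
         cylinder_solution L K mu) <->
      (exists mu : measure_family A,
         [/\ local_solutions L K mu, exact_system (@fin_gen R A) mu
           & exists2 muL : measure_family A,
               corresponding_system mu muL & thick muL]),
      (* (ii), supplement *)
      forall Q : set A, quadratic_module Q -> K = nonneg_set Q ->
        qm_count_gen Q ->
        forall mu : {measure set (cylinder_space A) -> \bar R},
          cylinder_solution L K mu -> representing L K mu
    & (* (iii) *)
      (exists nu : {measure set (borel_space (char_space A)) -> \bar R},
         radon_representing L K nu) <->
      (exists mu : measure_family A,
         local_solutions L K mu /\ prokhorov mu)].
Proof.
move=> L1 Kcl LK.
have local S : fin_gen S -> exists nu : {measure set
    (borel_space (char_space (subalg S))) -> \bar R},
    radon_representing (restr_lin L S) (closure (@restr R A S @` K)) nu.
  move=> Sf; apply: haviland => //; first exact: closed_closure.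
  (* An element of [S] nonnegative on the closure of the image of [K] is, as an element of [A],
     nonnegative on [K]. *)
  move=> a aK; apply: LK => x Kx; rewrite -[char_eval _ x]/(char_eval a (restr S x)).
  by apply: aK; apply: subset_closure; exists x.
split=> //.
- split=> [[m]|[mu [muP _ [muL muLP muLt]]]]; first exact: cylinder_solution_systems.
  exact: thick_cylinder_solution muP muLP muLt.
- by move=> Q Qq KQ Qc m; exact: (cylinder_solution_supported KQ Qc).
- split=> [[nu]|[mu [muP muC]]]; first exact: radon_representing_prokhorov L1.
  exact: prokhorov_representing muP muC.
Qed.
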